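(* Suppose that each $f_i:\mathbb R^d\to\mathbb R$ is continuously differentiable, that there is $L>0$ with $\|\nabla f_i(x)-\nabla f_i(y)\|\le L\|x-y\|$ for all $x,y\in\mathbb R^d$ and all $i$, and that $f$ is bounded below, with optimal value $f^\star=\inf f\in\mathbb R$. Suppose also that the random variables $\xi_i^{(k)}$, $k\in\mathbb N$, $i=1,\dots,n$, are independent of each other, that $\mathbb E_k[\nabla F_i(x_i^{(k)};\xi_i^{(k)})]=\nabla f_i(x_i^{(k)})$ for all $k,i$, and that there is $\sigma>0$ such that $\mathbb E_k[\|\nabla F_i(x_i^{(k)};\xi_i^{(k)})-\nabla f_i(x_i^{(k)})\|^2]\le\sigma^2$ for all $k,i$. Let the mixing matrices $\{W^{(l)}\}_{l=0}^{\tau-1}\subset\mathbb R^{n\times n}$ have the finite-time consensus property with parameter $\tau\ge1$, and let the stepsize satisfy $\alpha\in\big(0,\frac{1}{4\sqrt6\,\tau^2L}\big]$. Then there exist constants $\gamma_1,\gamma_2,\gamma_3,\gamma_4,\gamma_5>0$, where $\gamma_3,\gamma_4,\gamma_5$ are absolute numerical constants, $\gamma_1$ depends only on $\mathbb E[f(\bar x^{(0)})-f^\star]$, and $\gamma_2$ depends only on $\sum_{k=0}^{\tau}\mathbb E\|\hat{\boldsymbol x}^{(k)}\|^2$, such that for all integers $T\ge\tau$ the sequence $\{\boldsymbol x^{(k)}\}$ generated by GT-FT satisfies $$\frac1{T+1}\sum_{k=0}^{T}\Big(\mathbb E\|\overline{\nabla f}(\boldsymbol x^{(k)})\|^2+\mathbb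 E\|\nabla f(\bar x^{(k)})\|^2\Big)\le\frac{\gamma_1}{\alpha T}+\frac{\gamma_2L^2}{nT}+\frac{\gamma_3\alpha^4\tau^4L^4\sigma^2}{n}+\gamma_4\alpha^2\tau^3L^2\sigma^2+\frac{\gamma_5\alpha L\sigma^2}{n}.$$
   Context: Problem: minimize $f(x)=\frac1n\sum_{i=1}^nf_i(x)$ over $x\in\mathbb R^d$, where $f_i(x)=\mathbb E_{\xi_i}[F_i(x;\xi_i)]$ and $\xi_i$ is a random variable on a probability space $(\Omega_i,\mathcal F_i,\mathbb P_i)$. $\|\cdot\|$ is the Euclidean norm and $\mathbf 1$ the all-ones vector in $\mathbb R^n$. No convexity is assumed. Finite-time consensus property with parameter $\tau\ge1$: all $W^{(0)},\dots,W^{(\tau-1)}\in\mathbb R^{n\times n}$ are doubly stochastic and $W^{(\tau-1)}W^{(\tau-2)}\cdots W^{(0)}=\frac1n\mathbf 1\mathbf 1^{\mathsf T}$. Algorithm GT-FT with stepsize $\alpha>0$: given initial points $x_i^{(0)}\in\mathbb R^d$, set $g_i^{(0)}=\nabla F_i(x_i^{(0)};\xi_i^{(0)})$, $i=1,\dots,n$. Stack $\boldsymbol x^{(k)}=(x_1^{(k)},\dots,x_n^{(k)})\in\mathbb R^{dn}$, $\boldsymbol g^{(k)}=(g_1^{(k)},\dots,g_n^{(k)})\in\mathbb R^{dn}$, $\nabla\boldsymbol F^{(k)}=(\nabla F_1(x_1^{(k)};\xi_1^{(k)}),\dots,\nabla F_n(x_n^{(k)};\xi_n^{(k)}))$, where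 gradients of $F_i$ are in the first argument. For $k=0,1,2,\dots$, with $\boldsymbol W^{(k)}=W^{(\mathrm{mod}(k,\tau))}\otimes I_d$ (the matrices are cycled through periodically in the order $W^{(0)},W^{(1)},\dots,W^{(\tau-1)}$), $$\boldsymbol x^{(k+1)}=\boldsymbol W^{(k)}(\boldsymbol x^{(k)}-\alpha\boldsymbol g^{(k)}),\qquad \boldsymbol g^{(k+1)}=\boldsymbol W^{(k)}\boldsymbol g^{(k)}+\nabla\boldsymbol F^{(k+1)}-\nabla\boldsymbol F^{(k)}.$$ Notation: $\bar x^{(k)}=\frac1n\sum_{i=1}^nx_i^{(k)}$, $\hat{\boldsymbol x}^{(k)}=\boldsymbol x^{(k)}-\mathbf 1\otimes\bar x^{(k)}$, $\overline{\nabla f}(\boldsymbol x^{(k)})=\frac1n\sum_{i=1}^n\nabla f_i(x_i^{(k)})$. Let $\mathcal F^{(k)}$ be the $\sigma$-algebra generated by the initial conditions and $\boldsymbol x^{(1)},\dots,\boldsymbol x^{(k)}$, and $\mathbb E_k[\cdot]=\mathbb E[\cdot\mid\mathcal F^{(k)}]$. *)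

(* Defs.v *)
From HB Require Import structures.
From mathcomp Require Import all_boot all_order all_algebra.
From mathcomp Require Import all_classical all_reals all_analysis.

Set Implicit Arguments.
Unset Strict Implicit.
Unset Printing Implicit Defensive.

Import Order.TTheory GRing.Theory Num.Theory.
Import numFieldNormedType.Exports.

Local Open Scope classical_set_scope.
Local Open Scope ring_scope.

(* The norm `|A| that MathComp-Analysis puts on matrices is the sup norm, so the
   Euclidean norm is defined here.  On a row vector it is the norm of R^d; on an
   n x d matrix, whose rows are the blocks of a stacked vector, it is the norm
   of R^(dn). *)
Definition enorm {R : realType} {m d : nat} (A : 'M[R]_(m, d)) : R :=
  Num.sqrt (\sum_i \sum_j A i j ^+ 2).

Definition grad {R : realType} {d : nat} (h : 'rV[R]_d -> R) (x : 'rV[R]_d) :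
    'rV[R]_d :=
  \row_j 'D_(delta_mx 0 j) (h : 'rV[R]_d -> R^o) x.

Definition continuously_differentiable {R : realType} {d : nat}
    (h : 'rV[R]_d -> R) : Prop :=
  (forall x, differentiable (h : 'rV[R]_d -> R^o) x) /\ continuous (grad h).

Definition doubly_stochastic {R : realType} {n : nat} (W : 'M[R]_n) : Prop :=
  [/\ forall i j, 0 <= W i j,
      forall i, \sum_j W i j = 1
    & forall j, \sum_i W i j = 1].

(* Only W 0, ..., W tau.-1 matter.  The big product runs over the decreasing
   list tau - 1, ..., 1, 0, so it is W tau.-1 *m ... *m W 1 *m W 0. *)
Definition finite_time_consensus {R : realType} {n : nat} (tau : nat)
    (W : nat -> 'M[R]_n) : Prop :=
  (forall l, (l < tau)%N -> doubly_stochastic (W l)) /\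
  \big[mulmx/1%:M]_(l <- rev (iota 0 tau)) W l = const_mx n%:R^-1.

Section probability.
Context {R : realType} {d : measure_display} {T : measurableType d}.

(* The sigma-algebra on T generated by all the entries of a family of random
   matrices. *)
Definition sigma_mx {J : Type} {m p : nat} (X : J -> T -> 'M[R]_(m, p)) :
    set (set T) :=
  <<s [set A | exists j a b (B : set R),
         measurable B /\ A = (fun w => X j w a b) @^-1` B] >>.

Definition mutually_independent (P : probability T R) {I : eqType}
    (G : I -> set (set T)) : Prop :=
  forall (s : seq I) (A : I -> set T),
    uniq s -> (forall i, i \in s -> G i (A i)) ->
    P (\bigcap_(i in [set` s]) A i) = (\prod_(i <- s) P (A i))%E.

(* Y is a version of the conditional expectation E[X | G]. *)
Definition is_cond_expectation (P : probability T R) (G : set (set T))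
    (X Y : T -> R) : Prop :=
  [/\ P.-integrable setT (EFin \o X),
      P.-integrable setT (EFin \o Y),
      forall B : set R, measurable B -> G (Y @^-1` B)
    & forall A, G A -> (\int[P]_(w in A) (Y w)%:E = \int[P]_(w in A) (X w)%:E)%E].

End probability.

Section objective.
Context {R : realType} {n d : nat}.

(* f_i(x) = E[F_i(x; xi_i)], each xi_i living on its own probability space and
   taking its values in its own measurable space. *)
Definition local_objective
    {dO : 'I_n -> measure_display} {Omg : forall i, measurableType (dO i)}
    (P_ : forall i, probability (Omg i) R)
    {dX : 'I_n -> measure_display} {Xi : forall i, measurableType (dX i)}
    (xi : forall i, {mfun Omg i >-> Xi i})
    (F : forall i, 'rV[R]_d -> Xi i -> R) (i : 'I_n) (x : 'rV[R]_d) : R :=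
  fine ('E_(P_ i)[fun w => F i x (xi i w)])%E.

Definition objective (f : 'I_n -> 'rV[R]_d -> R) (x : 'rV[R]_d) : R :=
  n%:R^-1 * \sum_i f i x.

Definition avg_grad (f : 'I_n -> 'rV[R]_d -> R) (x : 'M[R]_(n, d)) : 'rV[R]_d :=
  n%:R^-1 *: \sum_i grad (f i) (row i x).

Definition row_mean (x : 'M[R]_(n, d)) : 'rV[R]_d :=
  n%:R^-1 *: \sum_i row i x.

Definition deviation (x : 'M[R]_(n, d)) : 'M[R]_(n, d) :=
  x - (const_mx 1 : 'cV[R]_n) *m row_mean x.
End objective.

Section gradient_tracking.
Context {R : realType} {n d : nat}.
Context {dT : measure_display} {T : measurableType dT}.
Context {dX : 'I_n -> measure_display} {Xi : forall i, measurableType (dX i)}.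
Variable F : forall i, 'rV[R]_d -> Xi i -> R.
Variable xi : forall i, nat -> {mfun T >-> Xi i}.

(* The stacked stochastic gradients at the point x: row i is the gradient of
   F_i in its first argument, at row i of x and the k-th sample of agent i. *)
Definition stoch_grad (k : nat) (w : T) (x : 'M[R]_(n, d)) : 'M[R]_(n, d) :=
  \matrix_i grad (fun y => F y (xi i k w)) (row i x).

(* The pair (x^(k), g^(k)).  Stacked vectors of R^(dn) are n x d matrices with
   blocks as rows, on which (W (x) I_d) acts as left multiplication by W. *)
Fixpoint gt_ft (tau : nat) (W : nat -> 'M[R]_n) (alpha : R)
    (x0 : T -> 'M[R]_(n, d)) (k : nat) (w : T) :
    'M[R]_(n, d) * 'M[R]_(n, d) :=
  if k is k'.+1 then
    let: (x, g) := gt_ft tau W alpha x0 k' w in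
    let x' := W (k' %% tau)%N *m (x - alpha *: g) in
    (x', W (k' %% tau)%N *m g + stoch_grad k'.+1 w x' - stoch_grad k' w x)
  else (x0 w, stoch_grad 0 w (x0 w)).

Definition gt_ft_x (tau : nat) (W : nat -> 'M[R]_n) (alpha : R)
    (x0 : T -> 'M[R]_(n, d)) (k : nat) (w : T) : 'M[R]_(n, d) :=
  (gt_ft tau W alpha x0 k w).1.

(* Index None is the initial point, index Some (i, k) the k-th sample of
   agent i. *)
Definition sampling_sigma (x0 : T -> 'M[R]_(n, d)) (q : option ('I_n * nat)) :
    set (set T) :=
  if q is Some (i, k) then preimage_set_system setT (xi i k) measurable
  else sigma_mx (fun _ : unit => x0).

End gradient_tracking.

Definition history {R : realType} {d : measure_display} {T : measurableType d}
    {m p : nat} (x : nat -> T -> 'M[R]_(m, p)) (k : nat) : set (set T) :=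
  sigma_mx (fun j : 'I_k.+1 => x j).

(* Main.v *)
(** Write y^k = p^k + s^k for the stacked stochastic gradients, with p^k the true
gradients and s^k the noise. Only products of mixing matrices over aligned blocks
are known to average exactly, so x^k is unrolled from the start of the block
preceding that of k: the initial terms disappear under the deviation, and the
deviation of x^k becomes a weighted sum of products of mixing matrices applied to
the increments y^l - y^(l-1) over fewer than 2 tau steps. The increments of p are
controlled by those of x (Lipschitz gradients) and contribute at most
32 alpha^2 L^2 tau^4 <= 1/3 of the accumulated deviations, which is absorbed on
the left; the noise terms are uncorrelated, so they contribute tau^3 rather than
tau^4. Combined with the descent inequality along the averages, this gives the
bound by telescoping.

The history is generated by the iterates alone and, W being possibly singular,
need not determine the past noise. That s_i^k is orthogonal to every
square-integrable function of the initial point and of the other samples comes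
from Fubini: xi_i^k is independent of all of them, so the conditional mean of
s_i^k is a function of x^k, which the unbiasedness assumption forces to vanish. *)

Require Import Defs.
From HB Require Import structures.
From mathcomp Require Import all_boot all_order all_algebra.
From mathcomp Require Import all_classical all_reals all_analysis.
From mathcomp Require Import measurable_realfun.
From mathcomp Require Import zify ring lra.

Set Implicit Arguments.
Unset Strict Implicit.
Unset Printing Implicit Defensive.

Import Order.TTheory GRing.Theory Num.Theory.
Import numFieldNormedType.Exports.

Local Open Scope classical_set_scope.
Local Open Scope ring_scope.

(** * Squared norms, mixing and deviations *)

Section squared_norm.
Context {R : realType}.

(** Of the moments that enter the estimate, only the noise variances, the mean initial gap and the
    mean squared deviations up to step [tau] are known to be finite at the outset. A strong
    induction propagates integrability to all steps by the same pointwise inequalities that later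
    give the rate; smoothness and the lower bound on the objective turn an integrable gap into a
    square-integrable gradient. Expectations are real numbers ([mean]) throughout and are exchanged
    for ['E_P] only at the end.

    Measurability is the other obstacle: [F] is measurable in the sample at each fixed point and
    differentiable in the point, so measurability along random points comes from rounding the point
    to a grid, then from difference quotients. It is required on [Om] and on coarser sigma-algebras
    over the same set, hence statements about an arbitrary map [e : S -> Om].

    An increment of the stochastic gradients carries noise at two consecutive times. The two noise
    sums are separated, so that within each the terms are uncorrelated.

    The stepsize constant satisfies [(4 * sqrt 6)^2 = 96 = 3 * 32], which is what makes the absorbed
    fraction one third. *)

Definition sqnorm {m d : nat} (A : 'M[R]_(m, d)) : R := \sum_i \sum_j A i j ^+ 2.

Lemma sqnorm_ge0 {m d} (A : 'M[R]_(m, d)) : 0 <= sqnorm A.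
Proof. by apply: sumr_ge0 => i _; apply: sumr_ge0 => j _; exact: sqr_ge0. Qed.

Lemma enorm_sqr {m d} (A : 'M[R]_(m, d)) : enorm A ^+ 2 = sqnorm A.
Proof. by rewrite /enorm sqr_sqrtr//; exact: sqnorm_ge0. Qed.

Lemma sqnorm_row {m d} (A : 'M[R]_(m, d)) : sqnorm A = \sum_i sqnorm (row i A).
Proof.
apply: eq_bigr => i _; rewrite /sqnorm big_ord1.
by apply: eq_bigr => j _; rewrite mxE.
Qed.

Lemma sqnorm_rV {d} (u : 'rV[R]_d) : sqnorm u = \sum_j u 0 j ^+ 2.
Proof. by rewrite /sqnorm big_ord1. Qed.

Lemma sqnormZ {m d} (a : R) (A : 'M[R]_(m, d)) : sqnorm (a *: A) = a ^+ 2 * sqnorm A.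
Proof.
rewrite /sqnorm mulr_sumr; apply: eq_bigr => i _.
by rewrite mulr_sumr; apply: eq_bigr => j _; rewrite mxE exprMn.
Qed.

Lemma sqnormN {m d} (A : 'M[R]_(m, d)) : sqnorm (- A) = sqnorm A.
Proof. by rewrite -scaleN1r sqnormZ sqrrN expr1n mul1r. Qed.

Lemma sqnormD_le {m d} (A B : 'M[R]_(m, d)) :
  sqnorm (A + B) <= 2 * sqnorm A + 2 * sqnorm B.
Proof.
rewrite /sqnorm !mulr_sumr -big_split; apply: ler_sum => i _ /=.
rewrite !mulr_sumr -big_split; apply: ler_sum => j _ /=; rewrite mxE.
have := sqr_ge0 (A i j - B i j); nra.
Qed.

Lemma sqnormB_le {m d} (A B : 'M[R]_(m, d)) :
  sqnorm (A - B) <= 2 * sqnorm A + 2 * sqnorm B.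
Proof. by rewrite -(sqnormN B); exact: sqnormD_le. Qed.

Lemma sqnorm_entry {m d} (A : 'M[R]_(m, d)) i j : A i j ^+ 2 <= sqnorm A.
Proof.
rewrite /sqnorm (bigD1 i)//= (bigD1 j)//= -addrA lerDl addr_ge0//.
  by apply: sumr_ge0 => k _; exact: sqr_ge0.
by apply: sumr_ge0 => k _; apply: sumr_ge0 => l _; exact: sqr_ge0.
Qed.

(** Weighted Cauchy-Schwarz. In the induction the cross term [2 * v i * C] is at most
    [A * v i ^+ 2 + B] because the difference is the sum of [a j * (v i - v j) ^+ 2]. *)
Lemma sqr_weighted_sum_le (I : Type) (r : seq I) (Q : pred I) (a v : I -> R) :
  (forall i, Q i -> 0 <= a i) ->
  (\sum_(i <- r | Q i) a i * v i) ^+ 2 <=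
  (\sum_(i <- r | Q i) a i) * \sum_(i <- r | Q i) a i * v i ^+ 2.
Proof.
move=> a0; elim: r => [|i r IH]; first by rewrite !big_nil expr0n mul0r.
rewrite !big_cons; case: ifPn => // Qi.
set A := \sum_(_ <- _ | _) a _; set B := \sum_(_ <- _ | _) a _ * _ ^+ 2.
set C := \sum_(_ <- _ | _) a _ * v _ in IH *.
have A0 : 0 <= A by apply: sumr_ge0.
have B0 : 0 <= B by apply: sumr_ge0 => j Qj; rewrite mulr_ge0 ?a0 ?sqr_ge0.
have key : 2 * v i * C <= A * v i ^+ 2 + B.
  suff -> : A * v i ^+ 2 + B = 2 * v i * C + \sum_(j <- r | Q j) a j * (v i - v j) ^+ 2.
    by rewrite lerDl; apply: sumr_ge0 => j Qj; rewrite mulr_ge0 ?a0 ?sqr_ge0.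
  rewrite /A /B /C mulr_suml mulr_sumr -!big_split /=; apply: eq_bigr => j _; ring.
have ai0 := a0 _ Qi.
apply: (@le_trans _ _ (a i ^+ 2 * v i ^+ 2 + a i * (A * v i ^+ 2 + B) + A * B)).
  apply: (@le_trans _ _ (a i ^+ 2 * v i ^+ 2 + a i * (2 * v i * C) + A * B)).
    rewrite [leLHS](_ : _ = a i ^+ 2 * v i ^+ 2 + a i * (2 * v i * C) + C ^+ 2); last by ring.
    by rewrite lerD2l.
  by rewrite lerD2r lerD2l ler_wpM2l.
by rewrite le_eqVlt; apply/orP; left; apply/eqP; ring.
Qed.

(** Applied with two kinds of weights: a row of a stochastic matrix, where it is Jensen's
    inequality, and the lags [m] of a window, whose sum is of order [tau ^+ 2]. *)
Lemma sqnorm_weighted_sum_le (I : Type) (r : seq I) (Q : pred I) (a : I -> R) {m d}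
    (v : I -> 'M[R]_(m, d)) :
  (forall i, Q i -> 0 <= a i) ->
  sqnorm (\sum_(i <- r | Q i) a i *: v i) <=
  (\sum_(i <- r | Q i) a i) * \sum_(i <- r | Q i) a i * sqnorm (v i).
Proof.
move=> a0; rewrite /sqnorm.
have -> : \sum_(i <- r | Q i) a i * (\sum_k \sum_l v i k l ^+ 2) =
    \sum_k \sum_l \sum_(i <- r | Q i) a i * v i k l ^+ 2.
  under [RHS]eq_bigr do rewrite exchange_big.
  rewrite exchange_big; apply: eq_bigr => i _.
  by rewrite mulr_sumr; apply: eq_bigr => k _; rewrite mulr_sumr.
rewrite mulr_sumr; apply: ler_sum => k _.
rewrite mulr_sumr; apply: ler_sum => l _.
rewrite summxE; under eq_bigr do rewrite mxE.
exact: sqr_weighted_sum_le.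
Qed.

End squared_norm.

Section mixing.
Context {R : realType} {n : nat}.
Implicit Types W : 'M[R]_n.

Lemma doubly_stochastic_mul W V :
  doubly_stochastic W -> doubly_stochastic V -> doubly_stochastic (W *m V).
Proof.
move=> [W0 Wr Wc] [V0 Vr Vc]; split=> [i j|i|j].
- by rewrite mxE; apply: sumr_ge0 => k _; rewrite mulr_ge0.
- under eq_bigr do rewrite mxE.
  rewrite exchange_big/= -[RHS](Wr i); apply: eq_bigr => k _.
  by rewrite -mulr_sumr Vr mulr1.
- under eq_bigr do rewrite mxE.
  rewrite exchange_big/= -[RHS](Vc j); apply: eq_bigr => k _.
  by rewrite -mulr_suml Wc mul1r.
Qed.

Lemma doubly_stochastic1 : doubly_stochastic (1%:M : 'M[R]_n).
Proof.
split=> [i j|i|j].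
- by rewrite mxE; case: (_ == _); rewrite ?ler01.
- rewrite (bigD1 i)//= mxE eqxx big1 ?addr0// => j ji.
  by rewrite mxE eq_sym (negbTE ji).
- rewrite (bigD1 j)//= mxE eqxx big1 ?addr0// => i ji.
  by rewrite mxE (negbTE ji).
Qed.

Lemma doubly_stochastic_le1 W i j : doubly_stochastic W -> W i j <= 1.
Proof.
move=> [W0 Wr _]; rewrite -(Wr i) (bigD1 j)//= lerDl.
by apply: sumr_ge0 => k _.
Qed.

(** Entries lie between 0 and 1, so their squares are at most themselves, and the entries sum to
    [n]. This Frobenius bound is the one that matters for uncorrelated noise rows. *)
Lemma doubly_stochastic_sqnorm_le W : doubly_stochastic W -> sqnorm W <= n%:R.
Proof.
move=> dW; case: (dW) => W0 Wr _.
rewrite -[n in n%:R]card_ord -sum1_card natr_sum; apply: ler_sum => i _.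
rewrite -(Wr i); apply: ler_sum => j _.
by rewrite expr2 ler_piMr// doubly_stochastic_le1.
Qed.

(** Each row of [W *m A] is a convex combination of the rows of [A]; convexity uses the row sums,
    and the column sums then collect every row of [A] with total weight one. *)
Lemma doubly_stochastic_contraction {d} W (A : 'M[R]_(n, d)) :
  doubly_stochastic W -> sqnorm (W *m A) <= sqnorm A.
Proof.
move=> [W0 Wr Wc]; rewrite [leRHS]sqnorm_row sqnorm_row.
apply: (@le_trans _ _ (\sum_i \sum_j W i j * sqnorm (row j A))).
  apply: ler_sum => i _; rewrite row_mul mulmx_sum_row.
  under eq_bigr do rewrite mxE.
  by apply: le_trans (sqnorm_weighted_sum_le _ _ _) _ => //; rewrite Wr mul1r.
by rewrite exchange_big; apply: ler_sum => j _ /=; rewrite -mulr_suml Wc mul1r.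
Qed.

End mixing.

Section deviations.
Context {R : realType} {n d : nat}.
Implicit Types (A B : 'M[R]_(n, d)) (W : 'M[R]_n).

Lemma row_mean_linear (a : R) A B : row_mean (a *: A + B) = a *: row_mean A + row_mean B.
Proof.
rewrite /row_mean scalerA mulrC -scalerA -scalerDr; congr (_ *: _).
by rewrite scaler_sumr -big_split; apply: eq_bigr => i _; rewrite linearP.
Qed.

(** With [row_mean] and [deviation] registered as linear maps, measurability and square
    integrability pass through them by the general lemmas on linear maps of random matrices. *)
HB.instance Definition _ :=
  GRing.isLinear.Build R 'M[R]_(n, d) 'rV[R]_d _ row_mean row_mean_linear.

Lemma deviation_linear (a : R) A B :
  deviation (a *: A + B) = a *: deviation A + deviation B.
Proof.
by rewrite /deviation linearP mulmxDr -scalemxAr opprD addrACA -scalerBr.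
Qed.

HB.instance Definition _ :=
  GRing.isLinear.Build R 'M[R]_(n, d) 'M[R]_(n, d) _ deviation deviation_linear.

Lemma row_meanD A B : row_mean (A + B) = row_mean A + row_mean B.
Proof. exact: linearD. Qed.

Lemma row_meanB A B : row_mean (A - B) = row_mean A - row_mean B.
Proof. exact: linearB. Qed.

Lemma row_meanZ (a : R) A : row_mean (a *: A) = a *: row_mean A.
Proof. exact: linearZ. Qed.

Lemma deviationD A B : deviation (A + B) = deviation A + deviation B.
Proof. exact: linearD. Qed.

Lemma deviationB A B : deviation (A - B) = deviation A - deviation B.
Proof. exact: linearB. Qed.

Lemma deviationZ (a : R) A : deviation (a *: A) = a *: deviation A.
Proof. exact: linearZ. Qed.

Lemma deviation_sum (I : Type) (r : seq I) (Q : pred I) (A : I -> 'M[R]_(n, d)) :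
  deviation (\sum_(i <- r | Q i) A i) = \sum_(i <- r | Q i) deviation (A i).
Proof. exact: linear_sum. Qed.

Lemma row_mean_mul W A : doubly_stochastic W -> row_mean (W *m A) = row_mean A.
Proof.
move=> [_ _ Wc]; rewrite /row_mean; congr (_ *: _).
under eq_bigr do rewrite row_mul mulmx_sum_row.
rewrite exchange_big; apply: eq_bigr => j _ /=.
under eq_bigr do rewrite mxE.
by rewrite -scaler_suml Wc scale1r.
Qed.

Lemma row_ones_mul (u : 'rV[R]_d) i : row i ((const_mx 1 : 'cV[R]_n) *m u) = u.
Proof. by apply/rowP => j; rewrite !mxE big_ord1 !mxE mul1r. Qed.

Lemma row_deviation A i : row i (deviation A) = row i A - row_mean A.
Proof. by rewrite /deviation linearB/= row_ones_mul. Qed.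

Lemma deviation_average A : deviation ((const_mx n%:R^-1 : 'M[R]_n) *m A) = 0.
Proof.
apply/row_matrixP => i; rewrite row_deviation row0; apply/eqP; rewrite subr_eq0.
have rE k : row k ((const_mx n%:R^-1 : 'M[R]_n) *m A) = row_mean A.
  rewrite row_mul mulmx_sum_row /row_mean scaler_sumr.
  by apply: eq_bigr => j _; rewrite !mxE.
rewrite rE [eqbRHS]/row_mean; under [in eqbRHS]eq_bigr do rewrite rE.
rewrite sumr_const card_ord -[row_mean A *+ n]scaler_nat [_ *: (_ *: _)]scalerA.
have /gtn_eqF n0 : (0 < n)%N by case: n i {rE} => [[]|].
by rewrite mulVf ?scale1r// pnatr_eq0 n0.
Qed.

Lemma sum_deviation A : (0 < n)%N -> \sum_i (row i A - row_mean A) = 0.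
Proof.
move=> n0; rewrite sumrB sumr_const card_ord -[row_mean A *+ n]scaler_nat /row_mean scalerA.
by rewrite divff ?scale1r ?subrr// pnatr_eq0 -lt0n.
Qed.

(** Pythagoras: the rows of the deviation sum to zero, so the cross terms with the constant part
    vanish. *)
Lemma sqnorm_deviation A : (0 < n)%N ->
  sqnorm A = sqnorm (deviation A) + n%:R * sqnorm (row_mean A).
Proof.
move=> n0; rewrite sqnorm_row [sqnorm (deviation A)]sqnorm_row.
set u := row_mean A.
have -> : n%:R * sqnorm u = \sum_(i < n) sqnorm u.
  by rewrite sumr_const card_ord mulr_natl.
rewrite -big_split /=.
have cross : \sum_i \sum_j 2 * ((row i A - u) 0 j * u 0 j) = 0.
  rewrite exchange_big big1// => j _; rewrite -mulr_sumr -mulr_suml.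
  suff -> : \sum_i (row i A - u) 0 j = 0 by rewrite mul0r mulr0.
  by rewrite -summxE sum_deviation// mxE.
rewrite -[RHS]addr0 -[X in _ = _ + X]cross.
rewrite -big_split; apply: eq_bigr => i _ /=.
rewrite row_deviation !sqnorm_rV -!big_split; apply: eq_bigr => j _ /=.
by rewrite !mxE -/u; ring.
Qed.

Lemma sqnorm_deviation_le A : (0 < n)%N -> sqnorm (deviation A) <= sqnorm A.
Proof.
by move=> n0; rewrite [leRHS]sqnorm_deviation// lerDl mulr_ge0// sqnorm_ge0.
Qed.

Lemma sqnorm_row_mean_le A : (0 < n)%N -> sqnorm (row_mean A) <= n%:R^-1 * sqnorm A.
Proof.
move=> n0; rewrite [in leRHS]sqnorm_deviation// mulrDr mulKf ?pnatr_eq0 ?gtn_eqF//.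
by rewrite lerDr mulr_ge0// sqnorm_ge0.
Qed.

End deviations.

Section transition.
Context {R : realType} {n : nat} (tau : nat) (W : nat -> 'M[R]_n).
Hypotheses (tau_gt0 : (0 < tau)%N) (W_ftc : finite_time_consensus tau W).

(** The product of the [m] mixing matrices used at steps [k], ..., [k + m - 1], the latest one on
    the left. *)
Fixpoint transition (k m : nat) : 'M[R]_n :=
  if m is m'.+1 then W ((k + m') %% tau)%N *m transition k m' else 1%:M.

Lemma doubly_stochastic_cycled k : doubly_stochastic (W (k %% tau)%N).
Proof. by apply: W_ftc.1; rewrite ltn_mod. Qed.

Lemma doubly_stochastic_transition k m : doubly_stochastic (transition k m).
Proof.
elim: m => [|m IH] /=; first exact: doubly_stochastic1.
exact: doubly_stochastic_mul (doubly_stochastic_cycled _) IH.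
Qed.

Lemma transition_aligned k m : (tau %| k)%N -> (m <= tau)%N ->
  transition k m = \big[mulmx/1%:M]_(l <- rev (iota 0 m)) W l.
Proof.
move=> /dvdnP[q ->]; elim: m => [|m IH] mt; first by rewrite big_nil.
have -> : rev (iota 0 m.+1) = m :: rev (iota 0 m) by rewrite -addn1 iotaD rev_cat.
rewrite big_cons [transition _ _]/=.
by rewrite IH ?(ltnW mt)// modnMDl modn_small.
Qed.

(** Once a full aligned block has produced the averaging matrix, further factors on the left leave
    it unchanged, since their rows sum to one. *)
Lemma transition_consensus k r : (tau %| k)%N ->
  transition k (tau + r) = const_mx n%:R^-1.
Proof.
move=> tk; elim: r => [|r IH]; first by rewrite addn0 transition_aligned// W_ftc.2.
rewrite addnS /= IH; apply/matrixP => i j; rewrite !mxE.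
under eq_bigr do rewrite mxE.
by case: (doubly_stochastic_cycled (k + (tau + r))) => _ Wr _; rewrite -mulr_suml Wr mul1r.
Qed.

End transition.

(** * Smooth functions *)

Section smooth.
Context {R : realType} {d : nat}.
Implicit Types (u v x y : 'rV[R]_d) (h : 'rV[R]_d -> R).

Definition dot u v : R := \sum_j u 0 j * v 0 j.

(** Young's inequality; the difference of the two sides is a multiple of the sum of
    [(u 0 j - a * v 0 j) ^+ 2]. *)
Lemma dot_le u v (a : R) : 0 < a -> dot u v <= (2 * a)^-1 * sqnorm u + a / 2 * sqnorm v.
Proof.
move=> a0; rewrite !sqnorm_rV !mulr_sumr -big_split; apply: ler_sum => j _ /=.
rewrite -subr_ge0 (_ : _ - _ = (2 * a)^-1 * (u 0 j - a * v 0 j) ^+ 2); last by field; lra.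
by rewrite mulr_ge0 ?sqr_ge0// invr_ge0; lra.
Qed.

Lemma sqnormB u v : sqnorm (u - v) = sqnorm u + sqnorm v - 2 * dot u v.
Proof.
rewrite !sqnorm_rV /dot mulr_sumr -!big_split -sumrB; apply: eq_bigr => j _ /=.
by rewrite !mxE; ring.
Qed.

Lemma dotBl u v x : dot (u - v) x = dot u x - dot v x.
Proof. by rewrite /dot -sumrB; apply: eq_bigr => j _; rewrite !mxE mulrBl. Qed.

Lemma dotDr u v x : dot u (v + x) = dot u v + dot u x.
Proof. by rewrite /dot -big_split; apply: eq_bigr => j _; rewrite !mxE mulrDr. Qed.

Lemma dotZr u (a : R) x : dot u (a *: x) = a * dot u x.
Proof. by rewrite /dot mulr_sumr; apply: eq_bigr => j _; rewrite !mxE mulrCA. Qed.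

Lemma dotuu u : dot u u = sqnorm u.
Proof. by rewrite sqnorm_rV. Qed.

Lemma derive_grad h x v : differentiable (h : 'rV[R]_d -> R^o) x ->
  'D_v (h : 'rV[R]_d -> R^o) x = dot (grad h x) v.
Proof.
move=> dh; rewrite deriveE// [in LHS](row_sum_delta v) linear_sum.
apply: eq_bigr => j _; rewrite linearZ /grad mxE deriveE//.
by rewrite mulrC.
Qed.

Lemma is_derive_line h x v (t : R) : differentiable (h : 'rV[R]_d -> R^o) (t *: v + x) ->
  is_derive t (1 : R) ((fun s : R => h (s *: v + x)) : R -> R^o) (dot (grad h (t *: v + x)) v).
Proof.
move=> dh.
have dl : is_diff t ((fun s : R => s *: v + x) : R -> 'rV[R]_d) ( *:%R ^~ v).
  rewrite (_ : (fun s : R => s *: v + x) = ( *:%R ^~ v : R^o -> 'rV[R]_d) + cst x)//.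
  by apply: is_diff_eq; rewrite addr0.
have dhl : differentiable ((fun s : R => h (s *: v + x)) : R -> R^o) t.
  exact: (@differentiable_comp _ _ _ _ (fun s : R => s *: v + x) h).
apply: DeriveDef; first exact: diff_derivable.
rewrite deriveE// [X in 'd X _](_ : _ = h \o (fun s : R => s *: v + x))//.
rewrite diff_comp//= diff_val scale1r -derive_grad// deriveE//.
Qed.

(** The descent lemma, without integration: the mean value theorem is applied to [h] along the
    segment minus the claimed quadratic bound, a function [g] whose derivative is nonpositive on the
    open unit interval. *)
Lemma smooth_upper_bound h (L : R) x y : 0 < L ->
  (forall z, differentiable (h : 'rV[R]_d -> R^o) z) ->
  (forall z z', enorm (grad h z - grad h z') <= L * enorm (z - z')) ->
  h y <= h x + dot (grad h x) (y - x) + L / 2 * sqnorm (y - x).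
Proof.
move=> L0 dh hL; set v := y - x; set c := dot _ v; set s := sqnorm v.
pose g (t : R) : R^o := h (t *: v + x) - t * c - L / 2 * s * t ^+ 2.
pose dg (t : R) : R := dot (grad h (t *: v + x)) v - c - L * s * t.
have gd t : is_derive t (1 : R) g (dg t).
  have ? := is_derive_line (dh (t *: v + x)).
  rewrite /g /dg; apply: is_derive_eq.
  by rewrite /GRing.scale/=; field.
have [t t01 gE] : exists2 t, t \in `]0, 1[%R & g 1 - g 0 = dg t * (1 - 0).
  apply: MVT => //; apply: derivable_within_continuous => t _.
  by apply: ex_derive.
have {}gE : g 1 - g 0 <= 0.
  move: t01; rewrite in_itv/= => /andP[t0 t1].
  rewrite gE subr0 mulr1 /dg /c -dotBl subr_le0.
  (* With Young's parameter [L * t], the two resulting terms are each at most [L * t / 2 * s] and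
     together cancel the term [L * s * t] of the derivative. *)
  have a0 : 0 < L * t by rewrite mulr_gt0.
  apply: le_trans (dot_le _ _ a0) _.
  have : sqnorm (grad h (t *: v + x) - grad h x) <= (L * t) ^+ 2 * s.
    rewrite exprMn -mulrA -sqnormZ -!enorm_sqr -exprMn.
    rewrite ler_pXn2r ?nnegrE ?mulr_ge0 ?(ltW L0)// ?sqrtr_ge0//.
    by apply: le_trans (hL _ _) _; rewrite addrK.
  move=> /(ler_wpM2l (_ : 0 <= (2 * (L * t))^-1)) h1.
  have : (2 * (L * t))^-1 * ((L * t) ^+ 2 * s) = L * t / 2 * s.
    by field; rewrite !gt_eqF.
  have := h1 (ltW _); rewrite invr_gt0 => /(_ ltac:(lra)).
  by rewrite -/s; lra.
move: gE; rewrite /g scale1r subrK scale0r add0r; lra.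
Qed.

(** One gradient step of length [L^-1] decreases [h] by at least [sqnorm (grad h x) / (2 * L)], and
    cannot go below [m]. It makes the gradient square-integrable as soon as the gap is
    integrable. *)
Lemma grad_sqnorm_le h (L m : R) x : 0 < L ->
  (forall z, differentiable (h : 'rV[R]_d -> R^o) z) ->
  (forall z z', enorm (grad h z - grad h z') <= L * enorm (z - z')) ->
  (forall z, m <= h z) ->
  sqnorm (grad h x) <= 2 * L * (h x - m).
Proof.
move=> L0 dh hL hm.
have := smooth_upper_bound x (x - L^-1 *: grad h x) L0 dh hL.
rewrite (_ : _ - x = - L^-1 *: grad h x); last by rewrite addrAC subrr add0r scaleNr.
rewrite dotZr sqnormZ dotuu sqrrN; set q := sqnorm _.
move=> /(le_trans (hm _)) h2.
have : L^-1 * q / 2 <= h x - m.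
  rewrite -subr_ge0; rewrite -subr_ge0 in h2; apply: le_trans h2 _.
  by rewrite le_eqVlt; apply/orP; left; apply/eqP; field; lra.
rewrite -(ler_pM2l (_ : 0 < 2 * L)); last lra.
by rewrite (_ : 2 * L * (L^-1 * q / 2) = q); last by field; lra.
Qed.

End smooth.

Section objective_gradient.
Context {R : realType} {n d : nat} (f : 'I_n -> 'rV[R]_d -> R).
Hypothesis f_diff : forall i x, differentiable (f i : 'rV[R]_d -> R^o) x.

Lemma objective_differentiable x : differentiable (objective f : 'rV[R]_d -> R^o) x.
Proof.
rewrite (_ : objective f = (n%:R^-1 : R) *: (\sum_i f i : 'rV[R]_d -> R^o)).
  by apply: differentiableZ; apply: differentiable_sum.
by apply/funext => y; rewrite /objective fctE fct_sumE.
Qed.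

Lemma grad_objective x : grad (objective f) x = n%:R^-1 *: \sum_i grad (f i) x.
Proof.
apply/rowP => j; rewrite !mxE summxE.
rewrite (_ : objective f = (n%:R^-1 : R) *: (\sum_i f i : 'rV[R]_d -> R^o)); last first.
  by apply/funext => y; rewrite /objective fctE fct_sumE.
rewrite deriveZ; last first.
  by apply: derivable_sum => i; exact: diff_derivable.
rewrite derive_sum; last by move=> i; exact: diff_derivable.
by congr (_ * _); apply: eq_bigr => i _; rewrite mxE.
Qed.

End objective_gradient.

(** * Measurability of gradients of Caratheodory functions *)

Section caratheodory.
Context {R : realType} {d : nat} {dS dX : measure_display}
  {S : measurableType dS} {Xi : measurableType dX}.
Variables (F : 'rV[R]_d -> Xi -> R) (X : S -> 'rV[R]_d) (z : S -> Xi).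
Hypothesis F_meas : forall x, measurable_fun setT (F x).
Hypothesis X_meas : forall j, measurable_fun setT (fun w => X w 0 j).
Hypothesis z_meas : measurable_fun setT z.

(** [X] is rounded down coordinatewise to the grid of mesh [1 / m.+1]. The rounded point takes
    countably many values, indexed by integer vectors, and on each cell only measurability of [F] at
    a fixed point is involved. *)
Let grid_point (m : nat) (k : 'rV[int]_d) : 'rV[R]_d :=
  \row_j ((k 0 j)%:~R / m.+1%:R).

Let cell (m : nat) (w : S) : 'rV[int]_d := \row_j Num.floor (m.+1%:R * X w 0 j).

Let cell_measurable m k : measurable [set w | cell m w = k].
Proof.
have -> : [set w | cell m w = k] =
    \bigcap_(j in [set: 'I_d]) ((fun w => m.+1%:R * X w 0 j) @^-1`
       `[(k 0 j)%:~R, (k 0 j + 1)%:~R[%classic).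
  apply/seteqP; split => w /=.
    by move=> <- j _ /=; rewrite in_itv/= mxE floor_itv.
  by move=> h; apply/rowP => j; rewrite mxE; apply: floor_def; have := h j I; rewrite /= in_itv.
apply: fin_bigcap_measurable; first exact: finite_finset.
move=> j _; rewrite -[X in measurable X]setTI.
by apply: measurable_funM.
Qed.

Let grid_measurable m : measurable_fun setT (fun w => F (grid_point m (cell m w)) (z w)).
Proof.
move=> _ B mB; rewrite setTI.
have -> : (fun w => F (grid_point m (cell m w)) (z w)) @^-1` B =
    \bigcup_n (if unpickle n is Some k
               then [set w | cell m w = k] `&` (F (grid_point m k) \o z) @^-1` B
               else set0).
  apply/seteqP; split => w /=.
    by move=> Bw; exists (pickle (cell m w)) => //; rewrite pickleK.
  by move=> [n _]; case: unpickle => // k [<-].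
apply: bigcupT_measurable => n; case: unpickle => // k.
apply: measurableI; first exact: cell_measurable.
rewrite -[X in measurable X]setTI.
exact: (measurableT_comp (F_meas _) z_meas).
Qed.

(** Pointwise limit of the grid approximations: the rounded points converge to [X w], and continuity
    of [F] in the point carries the convergence over. *)
Lemma separately_measurable_comp :
  (forall a, continuous ((fun y => F y a) : 'rV[R]_d -> R^o)) ->
  measurable_fun setT (fun w => F (X w) (z w)).
Proof.
move=> F_cont; apply: (measurable_fun_cvg (h := fun m w =>
  F (grid_point m (cell m w)) (z w))) => // w _.
suff cX : (fun m => grid_point m (cell m w)) @ \oo --> X w.
  have FX := cvg_comp _ _ cX (F_cont (z w) (X w)). exact: FX.
apply/cvg_ballP => e e0; near=> m; split => // i j.
rewrite !ord1 !mxE /ball/=.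
have m0 : 0 < m.+1%:R :> R by rewrite ltr0n.
have /andP[h1 h2] := floor_itv (m.+1%:R * X w 0 j).
have h3 : m.+1%:R^-1 < e by near: m; exact: near_infty_natSinv_lt (PosNum e0).
move: h1 h2; set k := Num.floor _; rewrite intrD => h1 h2.
have -> : X w 0 j - k%:~R / m.+1%:R = (m.+1%:R * X w 0 j - k%:~R) / m.+1%:R.
  by field; rewrite gt_eqF.
rewrite ger0_norm; last by rewrite divr_ge0 ?(ltW m0)// subr_ge0.
apply: le_lt_trans h3; rewrite -[leRHS]mul1r ler_pM2r ?invr_gt0//.
by rewrite lerBlDl ltW.
Unshelve. all: by end_near. Qed.

End caratheodory.

Lemma grad_measurable {R : realType} {d : nat} {dS dX : measure_display}
    {S : measurableType dS} {Xi : measurableType dX}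
    (F : 'rV[R]_d -> Xi -> R) (X : S -> 'rV[R]_d) (z : S -> Xi) (c : 'I_d) :
  (forall x, measurable_fun setT (F x)) ->
  (forall a x, differentiable ((fun y => F y a) : 'rV[R]_d -> R^o) x) ->
  (forall j, measurable_fun setT (fun w => X w 0 j)) ->
  measurable_fun setT z ->
  measurable_fun setT (fun w => grad (fun y => F y (z w)) (X w) 0 c).
Proof.
move=> F_meas F_diff X_meas z_meas.
have F_cont a : continuous ((fun y => F y a) : 'rV[R]_d -> R^o).
  by move=> x; apply: differentiable_continuous.
pose e : 'rV[R]_d := delta_mx 0 c.
(* The double inverse keeps the expression literally a difference quotient with step [m.+1%:R^-1],
   so that its limit is read off from derivability. *)
apply: (measurable_fun_cvg (h := fun m w =>
  (m.+1%:R^-1)^-1 * (F ((m.+1%:R^-1) *: e + X w) (z w) - F (X w) (z w)))).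
  move=> m; apply: measurable_funM => //; apply: measurable_funB.
    apply: (separately_measurable_comp F_meas _ z_meas F_cont) => j.
    rewrite (_ : (fun w => _) = (fun w => (m.+1%:R^-1 *: e) 0 j + X w 0 j)); last first.
      by apply/funext => w; rewrite mxE.
    exact: measurable_funD.
  exact: (separately_measurable_comp F_meas X_meas z_meas F_cont).
move=> w _; rewrite mxE.
have h0 : (fun m : nat => m.+1%:R^-1 : R) @ \oo --> (0 : R)^'.
  move=> A /nbhs_ballP[r /= r0 rA].
  suff : \forall m \near \oo, A (m.+1%:R^-1 : R) by [].
  near=> m; apply: rA => //=.
  rewrite /ball/= sub0r normrN ger0_norm ?invr_ge0//.
  by near: m; exact: near_infty_natSinv_lt (PosNum r0).
have dF : derivable ((fun y => F y (z w)) : 'rV[R]_d -> R^o) (X w) e by exact: diff_derivable.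
exact: (cvg_comp _ _ h0 dF).
Unshelve. all: by end_near. Qed.

(** * Independence *)

Section independence.
Context {R : realType} {dT : measure_display} {T : measurableType dT} (P : probability T R).
Context {I : eqType} (G : I -> set (set T)).
Hypothesis G_indep : mutually_independent P G.
Hypothesis G_meas : forall i, G i `<=` measurable.
Hypothesis G_setT : forall i, G i setT.
Hypothesis G_setI : forall i, setI_closed (G i).

(** A pi-system: finite intersections of events attached to indices other than [q]. It generates the
    sigma-algebra of everything but [q]. *)
Definition others (q : I) : set (set T) :=
  [set B | exists (s : seq I) (A : I -> set T),
     [/\ uniq s, q \notin s, forall i, i \in s -> G i (A i)
       & B = \bigcap_(i in [set` s]) A i]].

Lemma others_setI_closed q : setI_closed (others q).
Proof.
move=> _ _ [s1 [A1 [u1 q1 G1 ->]]] [s2 [A2 [u2 q2 G2 ->]]].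
(* An index that occurs in only one of the two lists receives the whole space from the other. *)
exists (undup (s1 ++ s2)), (fun i => (if i \in s1 then A1 i else setT) `&`
  (if i \in s2 then A2 i else setT)); split.
- exact: undup_uniq.
- by rewrite mem_undup mem_cat negb_or q1.
- move=> i _; apply: G_setI.
    by case: ifPn => // /G1.
  by case: ifPn => // /G2.
- apply/seteqP; split => w /=.
    by move=> [h1 h2] i _; split; case: ifPn => // ?; [exact: h1|exact: h2].
  move=> h; split => i /= si.
    by have := h i; rewrite /= mem_undup mem_cat si => /(_ isT)[].
  by have := h i; rewrite /= mem_undup mem_cat si orbT => /(_ isT)[].
Qed.

Lemma others_sub q i : i != q -> G i `<=` others q.
Proof.
move=> iq A GA; exists [:: i], (fun=> A); split => //.
- by rewrite inE eq_sym.
- by move=> j; rewrite inE => /eqP ->.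
- by apply/seteqP; split => w /=; [move=> Aw j _|apply=> /=; exact: mem_head].
Qed.

Lemma others_meas q : others q `<=` measurable.
Proof.
move=> _ [s [A [_ _ GA ->]]]; apply: fin_bigcap_measurable; first exact: finite_seq.
by move=> i /= /GA; exact: G_meas.
Qed.

(** The finite measures [B |-> P (B & C)] and [B |-> P C * P B] agree on the pi-system [others q] by
    mutual independence, hence on the sigma-algebra that it generates. *)
Lemma others_indep q B C : <<s others q >> B -> G q C -> P (B `&` C) = (P B * P C)%E.
Proof.
move=> sB GC; have mC := G_meas GC.
have PC0 : (0 <= fine (P C))%R by apply: fine_ge0.
pose m1 : {measure set T -> \bar R} := mrestr P mC.
pose m2 : {measure set T -> \bar R} := mscale (NngNum PC0) P.
have m1E X : m1 X = P (X `&` C) by [].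
have m2E X : m2 X = (P C * P X)%E.
  by rewrite -[in RHS](fineK (fin_num_measure P C mC)).
have : m1 B = m2 B.
  apply: (@g_sigma_algebra_measure_unique _ _ T (others q) _ (fun=> setT)) => //.
  - exact: others_meas.
  - by move=> _; exists [::], (fun=> setT); split => //; rewrite bigcapT.
  - by rewrite bigcup_const//; exists 0%N.
  - exact: others_setI_closed.
  - move=> A [s [A_ [us qs GA ->]]]; rewrite /m1 /m2 /mrestr /mscale/=.
    apply: (etrans (m1E _)); apply: (etrans _ (esym (m2E _))).
    have := @G_indep s A_ us GA => ->.
    (* Independence is used for [s] and for [q :: s], with [C] placed at index [q]. *)
    pose A' i := if i == q then C else A_ i.
    have A'E i : i \in s -> A' i = A_ i.
      by rewrite /A'; case: eqP => // -> qs'; rewrite qs' in qs.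
    have := @G_indep (q :: s) A'; rewrite /= qs => /(_ us) h.
    rewrite big_cons in h; rewrite [X in (P X * _)%E](_ : A' q = C) in h; last first.
      by rewrite /A' eqxx.
    rewrite (eq_big_seq (P \o A_)) in h; last by move=> i /A'E /= ->.
    rewrite -h; last first.
      by move=> i; rewrite inE => /orP[/eqP ->|/[dup] /A'E -> /GA//]; rewrite /A' eqxx.
    congr (P _); apply/seteqP; split => w /=.
      move=> [h1 h2] i /=; rewrite inE => /orP[/eqP ->|si].
        by rewrite /A' eqxx.
      by rewrite A'E//; exact: h1.
    move=> h1; split => [i si|].
      by rewrite -(A'E i)//; apply: h1; rewrite /= inE si orbT.
    by have := h1 q; rewrite /= mem_head /A' eqxx; exact.
  - move=> k; rewrite m1E; apply: le_lt_trans (ltry 1).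
    by apply: probability_le1; exact: measurableI.
by rewrite m1E m2E muleC.
Qed.

End independence.

(** Tonelli gives the claim for the positive and negative parts, and the integral is by definition
    the difference of theirs. *)
Lemma measurable_partial_integral {R : realType} {d1 d2 : measure_display}
    {T1 : measurableType d1} {T2 : measurableType d2}
    (nu : {sigma_finite_measure set T2 -> \bar R}) (h : T1 * T2 -> \bar R) :
  measurable_fun setT h -> measurable_fun setT (fun x => \int[nu]_y h (x, y))%E.
Proof.
move=> mh; rewrite (_ : (fun x => _) =
    (fun x => \int[nu]_y h^\+ (x, y))%E \- (fun x => \int[nu]_y h^\- (x, y))%E)%E.
  apply: emeasurable_funB; apply: measurable_fun_fubini_tonelli_F => //.
    exact: measurable_funepos.
  exact: measurable_funeneg.
apply/funext => x; rewrite integralE.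
under eq_integral do rewrite funepos_comp/=.
by under [X in (_ - X)%E = _]eq_integral do rewrite funeneg_comp/=.
Qed.

Section independent_pair.
Local Open Scope ereal_scope.
Context {R : realType} {dT d1 d2 : measure_display} {T : measurableType dT}
  {T1 : measurableType d1} {T2 : measurableType d2} (P : probability T R).
Variables (Y : {mfun T >-> T1}) (Z : {mfun T >-> T2}).
Hypothesis YZ_indep : forall A B, measurable A -> measurable B ->
  P (Y @^-1` A `&` Z @^-1` B) = P (Y @^-1` A) * P (Z @^-1` B).

Let pair w := (Y w, Z w).
Let pair_meas : measurable_fun setT pair.
Proof. exact: measurable_fun_pair. Qed.
HB.instance Definition _ := isMeasurableFun.Build _ _ _ _ pair pair_meas.

(** Independence says that both measures agree on rectangles, which determines the product
    measure. *)
Let law_pair (D : set (T1 * T2)) : measurable D ->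
  (distribution P Y \x distribution P Z) D = distribution P pair D.
Proof.
move: D; have := @product_measure_unique _ _ _ _ _ (distribution P Y) (distribution P Z)
  (distribution P pair); apply => A B mA mB.
by rewrite /distribution /pushforward -YZ_indep.
Qed.

Let joint_integrable (h : T1 * T2 -> \bar R) : measurable_fun setT h ->
  P.-integrable setT (fun w => h (Y w, Z w)) ->
  (distribution P Y \x distribution P Z).-integrable setT h.
Proof.
move=> mh /integrableP[_ hi]; apply/integrableP; split => //.
rewrite (eq_measure_integral (distribution P pair)); last by move=> A mA _; exact: law_pair.
rewrite ge0_integral_pushforward//; exact: measurableT_comp.
Qed.

Let joint_integral (h : T1 * T2 -> \bar R) : measurable_fun setT h ->
  P.-integrable setT (fun w => h (Y w, Z w)) ->
  \int[P]_w h (Y w, Z w) =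
  \int[distribution P Y]_x \int[distribution P Z]_y h (x, y).
Proof.
move=> mh hi; rewrite (integral12_prod_meas1 (joint_integrable mh hi)).
rewrite (eq_measure_integral (distribution P pair)); last by move=> A mA _; exact: law_pair.
by rewrite integral_pushforward.
Qed.

(* The partial integral phi is the conditional expectation of h(Y, Z) given Y;
   testing it on {phi >= 0} and {phi < 0} shows that it vanishes. *)
Lemma independent_orthogonal (h : T1 * T2 -> R) (V : T1 -> R) :
  let phi x := \int[distribution P Z]_y (h (x, y))%:E in
  measurable_fun setT h -> measurable_fun setT V ->
  P.-integrable setT (fun w => (h (Y w, Z w))%:E) ->
  P.-integrable setT (fun w => (V (Y w) * h (Y w, Z w))%:E) ->
  (forall D, measurable D ->
     \int[P]_(w in [set w | D (phi (Y w))]) (h (Y w, Z w))%:E = 0) ->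
  \int[P]_w (V (Y w) * h (Y w, Z w))%:E = 0.
Proof.
move=> phi mh mV hi Vhi h0.
have mh' : measurable_fun setT (EFin \o h) by exact/measurable_EFinP.
have mphi : measurable_fun setT phi.
  exact: (measurable_partial_integral (distribution P Z) mh').
have hi' := joint_integrable mh' hi.
have phi0 D : measurable D -> \int[distribution P Y]_(x in phi @^-1` D) phi x = 0.
  move=> mD; have mA : measurable (phi @^-1` D) by rewrite -[X in measurable X]setTI; exact: mphi.
  rewrite -(h0 D mD) integral_mkcond [RHS]integral_mkcond.
  pose k := (EFin \o h) \_ (fst @^-1` (phi @^-1` D)).
  have mfst : measurable (fst @^-1` (phi @^-1` D) : set (T1 * T2)).
    by rewrite -[X in measurable X]setTI; exact: measurable_fst.
  have kE : (fun w => (h (Y w, Z w))%:E) \_ [set w | D (phi (Y w))] = fun w => k (Y w, Z w).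
    apply/funext => w; rewrite /k !patchE.
    have -> : (w \in [set w | D (phi (Y w))]) =
        ((Y w, Z w) \in (fst @^-1` (phi @^-1` D) : set (T1 * T2))).
      by apply/idP/idP; rewrite !inE.
    by [].
  rewrite kE joint_integral.
  - apply: eq_integral => x _; rewrite patchE; case: ifPn => xA.
      by apply: eq_integral => y _; rewrite /k patchE ifT.
    rewrite -[LHS](integral0 (distribution P Z) setT); apply: eq_integral => y _.
    by rewrite /k patchE ifF//; apply/negbTE; apply: contra xA => /set_mem xA; exact: mem_set.
  - by apply/(measurable_restrictT _ mfst); exact: measurable_funTS.
  - have mB : measurable [set w | D (phi (Y w))].
      rewrite (_ : [set w | _] = Y @^-1` (phi @^-1` D))//.
      by rewrite -[X in measurable X]setTI; exact: measurable_funPT.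
    by rewrite -kE -integrable_mkcond//; exact: integrableS hi.
have phi_ae : ae_eq (distribution P Y) setT phi (cst 0).
  apply/ae_eq_integral_abs => //.
  have m0 : measurable [set x : \bar R | 0 <= x] by rewrite -set_itvcy; exact: emeasurable_itv.
  have m0' : measurable [set x : \bar R | x < 0] by rewrite -set_itvNyo; exact: emeasurable_itv.
  have mp : measurable (phi @^-1` [set x | 0 <= x]).
    by rewrite -[X in measurable X]setTI; exact: mphi.
  have mn : measurable (phi @^-1` [set x | x < 0]).
    by rewrite -[X in measurable X]setTI; exact: mphi.
  have -> : setT = phi @^-1` [set x | 0 <= x] `|` phi @^-1` [set x | x < 0].
    by apply/seteqP; split => x //= _; case: (leP 0 (phi x)); [left|right].
  rewrite ge0_integral_setU//=.
  - rewrite (eq_integral phi); last by move=> x; rewrite inE/= => /gee0_abs.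
    rewrite phi0// add0e.
    rewrite (eq_integral (fun x => - phi x)); last first.
      by move=> x; rewrite inE/= => /lte0_abs.
    rewrite integralN/=; last first.
      have phii : (distribution P Y).-integrable setT phi by exact: integrable_fubini_F hi'.
      by apply: (integrable_add_def mn); exact: (integrableS measurableT mn (@subsetT _ _) phii).
    by rewrite phi0// oppe0.
  - by apply: measurable_funTS; exact: measurableT_comp.
  - by apply/disj_setPS => x [/=]; rewrite leNgt => /negP.
pose Vh (z : T1 * T2) := (V z.1 * h z)%R.
have mVh : measurable_fun setT (EFin \o Vh).
  apply/measurable_EFinP/measurable_funM => //; exact: measurableT_comp.
rewrite (joint_integral mVh Vhi).
rewrite -(integral0 (distribution P Y) setT).
apply: ae_eq_integral => //; first exact: (measurable_partial_integral (distribution P Z) mVh).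
(* Fubini makes [h (x, _)] integrable only for almost every [x]; for those, [V x] leaves the inner
   integral and multiplies [phi x = 0]. *)
apply: filterS2 phi_ae (ae_integrable1 hi') => x phix hx _.
rewrite /Vh/=; under eq_integral do rewrite EFinM.
by rewrite integralZl// -/(phi x) phix// mule0.
Qed.

End independent_pair.

(** * Square-integrable random matrices *)

Section square_integrable.
Context {R : realType} {dO : measure_display} {Om : measurableType dO} (P : probability Om R).
Implicit Types X Y : Om -> R.

Definition summable_rv X := P.-integrable setT (EFin \o X).

Definition mean X : R := \int[P]_w X w.

Definition L2 X := measurable_fun setT X /\ summable_rv (fun w => X w ^+ 2).

Lemma summable_rvD X Y :
  summable_rv X -> summable_rv Y -> summable_rv (fun w => X w + Y w).
Proof. by move=> iX iY; exact: (integrableD measurableT iX iY). Qed.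

Lemma summable_rvZ a X : summable_rv X -> summable_rv (fun w => a * X w).
Proof. by move=> iX; exact: (integrableZl measurableT a iX). Qed.

Lemma summable_rvB X Y :
  summable_rv X -> summable_rv Y -> summable_rv (fun w => X w - Y w).
Proof. by move=> iX iY; exact: (integrableB measurableT iX iY). Qed.

Lemma summable_rv_cst a : summable_rv (fun=> a).
Proof. exact: finite_measure_integrable_cst. Qed.

Lemma summable_rv_sum (I : Type) (r : seq I) (Q : pred I) (X : I -> Om -> R) :
  (forall i, Q i -> summable_rv (X i)) -> summable_rv (fun w => \sum_(i <- r | Q i) X i w).
Proof.
move=> iX; rewrite /summable_rv.
have -> : EFin \o (fun w => \sum_(i <- r | Q i) X i w) =
    (fun w => \sum_(i <- r | Q i) (X i w)%:E)%E.
  by apply/funext => w; rewrite /= sumEFin.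
by apply: integrable_sum.
Qed.

Lemma summable_rv_le X Y : measurable_fun setT X -> (forall w, `|X w| <= Y w) ->
  summable_rv Y -> summable_rv X.
Proof.
move=> mX XY; apply: le_integrable => //; first exact/measurable_EFinP.
by move=> w _; rewrite lee_fin (le_trans (XY w))// ler_norm.
Qed.

Lemma meanD X Y : summable_rv X -> summable_rv Y -> mean (fun w => X w + Y w) = mean X + mean Y.
Proof. exact: RintegralD. Qed.

Lemma meanB X Y : summable_rv X -> summable_rv Y -> mean (fun w => X w - Y w) = mean X - mean Y.
Proof. exact: RintegralB. Qed.

Lemma meanZ a X : summable_rv X -> mean (fun w => a * X w) = a * mean X.
Proof. exact: RintegralZl. Qed.

Lemma mean_le X Y : summable_rv X -> summable_rv Y -> (forall w, X w <= Y w) -> mean X <= mean Y.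
Proof. by move=> iX iY XY; apply: le_Rintegral. Qed.

Lemma mean_ge0 X : (forall w, 0 <= X w) -> 0 <= mean X.
Proof. by move=> X0; apply: Rintegral_ge0. Qed.

Lemma mean_cst a : mean (fun=> a) = a.
Proof. by rewrite /mean Rintegral_cst// [X in fine X]probability_setT mulr1. Qed.

Lemma mean_sum (I : Type) (r : seq I) (Q : pred I) (X : I -> Om -> R) :
  (forall i, Q i -> summable_rv (X i)) ->
  mean (fun w => \sum_(i <- r | Q i) X i w) = \sum_(i <- r | Q i) mean (X i).
Proof.
move=> iX; elim: r => [|i r IH].
  by under [in LHS]eq_fun do rewrite big_nil; rewrite mean_cst big_nil.
rewrite big_cons -IH; case: ifPn => Qi; last first.
  by congr mean; apply/funext => w; rewrite big_cons (negbTE Qi).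
rewrite -meanD//; [|exact: iX|exact: summable_rv_sum].
by congr mean; apply/funext => w; rewrite big_cons Qi.
Qed.

Lemma meanE X : summable_rv X -> 'E_P[X]%E = (mean X)%:E.
Proof. by move=> iX; rewrite unlock /mean fineK//; exact: integrable_fin_num. Qed.

Lemma ge0_summable_rv X : measurable_fun setT X -> (forall w, 0 <= X w) ->
  ('E_P[X] < +oo)%E -> summable_rv X.
Proof.
move=> mX X0; rewrite unlock => EX; apply/integrableP; split; first exact/measurable_EFinP.
by under eq_integral do rewrite /= ger0_norm//.
Qed.

Lemma L2_mul X Y : L2 X -> L2 Y -> summable_rv (fun w => X w * Y w).
Proof.
move=> [mX iX] [mY iY]; apply: summable_rv_le (summable_rvD iX iY).
  exact: measurable_funM.
move=> w; rewrite ler_norml; apply/andP; split.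
  have := sqr_ge0 (X w + Y w); nra.
have := sqr_ge0 (X w - Y w); nra.
Qed.

Lemma L2_le X Y : measurable_fun setT X -> (forall w, X w ^+ 2 <= Y w) ->
  summable_rv Y -> L2 X.
Proof.
move=> mX XY iY; split => //; apply: summable_rv_le iY; first exact: measurable_funX.
by move=> w; rewrite ger0_norm ?sqr_ge0.
Qed.

Lemma L2Z a X : L2 X -> L2 (fun w => a * X w).
Proof.
move=> [mX iX]; apply: (L2_le (Y := fun w => a ^+ 2 * X w ^+ 2)) => [||].
- exact: measurable_funM.
- by move=> w; rewrite exprMn.
- exact: summable_rvZ.
Qed.

Lemma L2D X Y : L2 X -> L2 Y -> L2 (fun w => X w + Y w).
Proof.
move=> [mX iX] [mY iY].
apply: (L2_le (Y := fun w => 2 * X w ^+ 2 + 2 * Y w ^+ 2)) => [||].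
- exact: measurable_funD.
- by move=> w; have := sqr_ge0 (X w - Y w); nra.
- by apply: summable_rvD; exact: summable_rvZ.
Qed.

Lemma L2_sum (I : Type) (r : seq I) (Q : pred I) (X : I -> Om -> R) :
  (forall i, Q i -> L2 (X i)) -> L2 (fun w => \sum_(i <- r | Q i) X i w).
Proof.
move=> iX; elim: r => [|i r IH].
  under eq_fun do rewrite big_nil; split; first exact: measurable_cst.
  exact: summable_rv_cst.
case/boolP : (Q i) => Qi.
  by under eq_fun do rewrite big_cons Qi; apply: L2D => //; exact: iX.
by under eq_fun do rewrite big_cons (negbTE Qi).
Qed.

Definition L2mx {m p} (X : Om -> 'M[R]_(m, p)) := forall i j, L2 (fun w => X w i j).

Lemma L2mx_linear {m p m' p'} (u : {linear 'M[R]_(m, p) -> 'M[R]_(m', p')})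
    (X : Om -> 'M[R]_(m, p)) :
  L2mx X -> L2mx (fun w => u (X w)).
Proof.
move=> iX i j.
rewrite (_ : (fun w => _) =
    fun w => \sum_k \sum_l u (delta_mx k l) i j * X w k l).
  by apply: L2_sum => k _; apply: L2_sum => l _; exact: L2Z.
apply/funext => w; rewrite [X w in LHS]matrix_sum_delta linear_sum summxE.
apply: eq_bigr => k _; rewrite linear_sum summxE; apply: eq_bigr => l _.
by rewrite linearZ mxE mulrC.
Qed.

Lemma L2mxZ {m p} a (X : Om -> 'M[R]_(m, p)) : L2mx X -> L2mx (fun w => a *: X w).
Proof. by move=> iX i j; under eq_fun do rewrite mxE; exact: L2Z. Qed.

Lemma L2mx_sum {m p} (I : Type) (r : seq I) (Q : pred I) (X : I -> Om -> 'M[R]_(m, p)) :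
  (forall i, Q i -> L2mx (X i)) -> L2mx (fun w => \sum_(i <- r | Q i) X i w).
Proof.
move=> iX i j; under eq_fun do rewrite summxE.
by apply: L2_sum => k Qk; exact: iX.
Qed.

Lemma sqnorm_summable {m p} (X : Om -> 'M[R]_(m, p)) :
  L2mx X -> summable_rv (fun w => sqnorm (X w)).
Proof.
move=> iX; apply: summable_rv_sum => i _; apply: summable_rv_sum => j _.
exact: (iX i j).2.
Qed.

Lemma mean_sqnorm {m p} (X : Om -> 'M[R]_(m, p)) : L2mx X ->
  mean (fun w => sqnorm (X w)) = \sum_i \sum_j mean (fun w => X w i j ^+ 2).
Proof.
move=> iX; rewrite mean_sum => [|i _].
  by apply: eq_bigr => i _; rewrite mean_sum// => j _; exact: (iX i j).2.
by apply: summable_rv_sum => j _; exact: (iX i j).2.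
Qed.

Lemma L2mx_le {m p} (X : Om -> 'M[R]_(m, p)) Y :
  (forall i j, measurable_fun setT (fun w => X w i j)) ->
  (forall w, sqnorm (X w) <= Y w) -> summable_rv Y -> L2mx X.
Proof.
move=> mX XY iY i j; apply: L2_le iY => // w.
exact: le_trans (sqnorm_entry _ _ _) (XY w).
Qed.

Lemma dot_summable {p} (X Y : Om -> 'rV[R]_p) :
  L2mx X -> L2mx Y -> summable_rv (fun w => dot (X w) (Y w)).
Proof. by move=> iX iY; apply: summable_rv_sum => j _; exact: L2_mul. Qed.

Lemma mean_sqr_uncorrelated (Q : finType) (a : Q -> R) (Y : Q -> Om -> R) :
  (forall q, L2 (Y q)) ->
  (forall q q', q != q' -> mean (fun w => Y q w * Y q' w) = 0) ->
  mean (fun w => (\sum_q a q * Y q w) ^+ 2) = \sum_q a q ^+ 2 * mean (fun w => Y q w ^+ 2).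
Proof.
move=> iY uY.
have -> : (fun w => (\sum_q a q * Y q w) ^+ 2) =
    (fun w => \sum_q \sum_q' (a q * a q') * (Y q w * Y q' w)).
  apply/funext => w; rewrite expr2 mulr_suml; apply: eq_bigr => q _.
  by rewrite mulr_sumr; apply: eq_bigr => q' _; rewrite mulrACA.
rewrite mean_sum => [|q _]; last first.
  by apply: summable_rv_sum => q' _; apply: summable_rvZ; exact: L2_mul.
apply: eq_bigr => q _; rewrite mean_sum => [|q' _]; last first.
  by apply: summable_rvZ; exact: L2_mul.
rewrite (bigD1 q)//= big1 ?addr0 => [|q' q'q].
  by rewrite meanZ ?expr2//; exact: L2_mul.
by rewrite meanZ ?uY ?mulr0//; [rewrite eq_sym|exact: L2_mul].
Qed.

(** Only the diagonal survives in the expanded square, coordinate by coordinate. The sum of squared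
    weights replaces the square of the sum that Cauchy-Schwarz would give, which is where a power of
    [tau] is saved. *)
Lemma mean_sqnorm_uncorrelated (Q : finType) {p} (a : Q -> R) (Y : Q -> Om -> 'rV[R]_p) (s : R) :
  (forall q, L2mx (Y q)) ->
  (forall q q' c, q != q' -> mean (fun w => Y q w 0 c * Y q' w 0 c) = 0) ->
  (forall q, mean (fun w => sqnorm (Y q w)) <= s) ->
  mean (fun w => sqnorm (\sum_q a q *: Y q w)) <= s * \sum_q a q ^+ 2.
Proof.
move=> iY uY sY.
rewrite mean_sqnorm; last by apply: L2mx_sum => q _; exact: L2mxZ.
rewrite big_ord1.
rewrite (eq_bigr (fun c => \sum_q a q ^+ 2 * mean (fun w => Y q w 0 c ^+ 2))) => [|c _]; last first.
  rewrite -mean_sqr_uncorrelated; [|by move=> q; exact: iY|by move=> q q' qq'; exact: uY].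
  by congr mean; apply/funext => w; rewrite summxE; under eq_bigr do rewrite mxE.
rewrite exchange_big mulr_sumr; apply: ler_sum => q _ /=.
rewrite -mulr_sumr mulrC ler_wpM2r ?sqr_ge0//.
by rewrite (le_trans _ (sY q))// mean_sqnorm// big_ord1.
Qed.

End square_integrable.

(** * The real recursions *)

Section recursions.
Context {R : realType}.

(** For a fixed lag [m], the indices [(k - m).-1] are distinct and below [N]; the guard keeps the
    natural-number subtraction from truncating. *)
Lemma sum_shift_le (a : nat -> R) m N : (forall j, 0 <= a j) ->
  \sum_(k < N.+1 | (m < k)%N) a (k - m).-1 <= \sum_(j < N) a j.
Proof.
move=> a0; have -> : \sum_(k < N.+1 | (m < k)%N) a (k - m).-1 = \sum_(j < N - m) a j.
  elim: N => [|N IH]; first by rewrite sub0n big_ord0 big_mkcond big_ord1.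
  rewrite big_mkcond big_ord_recr -big_mkcond /= {}IH.
  have [mN|Nm] := leqP m N.
    by rewrite ltnS mN subSn// big_ord_recr.
  by rewrite ltnS leqNgt Nm addr0 (eqP (ltnW Nm)) (eqP Nm : (N.+1 - m = 0)%N).
rewrite -(big_mkord xpredT a) -(big_mkord xpredT a).
rewrite [leRHS](@big_cat_nat _ _ _ (N - m))//= ?leq_subr// lerDl.
by apply: sumr_ge0.
Qed.

Lemma sum_nat_le (M : nat) : \sum_(m < M) m%:R <= M%:R ^+ 2 / 2 :> R.
Proof.
elim: M => [|M IH]; first by rewrite big_ord0 expr0n mul0r.
by rewrite big_ord_recr /= -natr1; nra.
Qed.

Lemma sum_sqr_nat_le (M : nat) : \sum_(m < M) m%:R ^+ 2 <= M%:R ^+ 3 :> R.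
Proof.
elim: M => [|M IH]; first by rewrite big_ord0 expr0n.
have M0 : 0 <= M%:R :> R by [].
rewrite big_ord_recr /= -natr1; nra.
Qed.

(** [D], [G], [H], [Delta] stand for the means of the squared deviation, of the squared averaged
    gradient, of the squared gradient at the averaged point, and of the gap to the infimum. *)
Variables (n tau : nat) (alpha L sigma : R) (D G H Delta : nat -> R).
Hypotheses (n_gt0 : (0 < n)%N) (tau_gt0 : (0 < tau)%N) (alpha_gt0 : 0 < alpha) (L_gt0 : 0 < L).
Hypothesis alpha_le : alpha <= 1 / (4 * Num.sqrt 6 * tau%:R ^+ 2 * L).
Hypotheses (D_ge0 : forall k, 0 <= D k) (G_ge0 : forall k, 0 <= G k)
  (H_ge0 : forall k, 0 <= H k) (Delta_ge0 : forall k, 0 <= Delta k).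

(** Bound on the mean squared length of the step from [j] to [j.+1]. *)
Let incr j := 2 * D j.+1 + 2 * D j + n%:R * alpha ^+ 2 * (2 * G j + 2 * (sigma ^+ 2 / n%:R)).

Hypothesis deviation_rec : forall k, (tau <= k)%N ->
  D k <= 4 * alpha ^+ 2 * tau%:R ^+ 2 * L ^+ 2 *
           (\sum_(m < (2 * tau).-1 | (m < k)%N) m%:R * incr (k - m).-1)
         + 64 * n%:R * tau%:R ^+ 3 * alpha ^+ 2 * sigma ^+ 2.
Hypothesis descent_rec : forall k,
  Delta k.+1 <= Delta k - alpha / 2 * H k - alpha / 2 * (1 - 2 * alpha * L) * G k
    + alpha * L ^+ 2 / (2 * n%:R) * D k + L * alpha ^+ 2 * sigma ^+ 2 / n%:R.

Let incr_ge0 j : 0 <= incr j.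
Proof.
have s0 : 0 <= sigma ^+ 2 / n%:R by rewrite divr_ge0 ?sqr_ge0.
have h : 0 <= n%:R * alpha ^+ 2 * (2 * G j + 2 * (sigma ^+ 2 / n%:R)).
  by apply: mulr_ge0; [rewrite mulr_ge0 ?sqr_ge0|rewrite addr_ge0// mulr_ge0].
by rewrite /incr addr_ge0// addr_ge0// mulr_ge0.
Qed.

Let nR_gt0 : 0 < n%:R :> R. Proof. by rewrite ltr0n. Qed.
Let tauR_ge1 : 1 <= tau%:R :> R. Proof. by rewrite ler1n. Qed.

(** The square of [4 * Num.sqrt 6] is 96. *)
Lemma stepsize_sqr_le : (alpha * L * tau%:R ^+ 2) ^+ 2 <= 96^-1.
Proof.
have s0 : 0 < Num.sqrt 6 :> R by rewrite sqrtr_gt0.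
have t0 : 0 < tau%:R :> R by rewrite ltr0n.
have h : alpha * L * tau%:R ^+ 2 <= (4 * Num.sqrt 6)^-1.
  apply: (@le_trans _ _ (1 / (4 * Num.sqrt 6 * tau%:R ^+ 2 * L) * L * tau%:R ^+ 2)).
    by rewrite !ler_pM2r// exprn_gt0.
  by rewrite le_eqVlt; apply/orP; left; apply/eqP; field; rewrite !gt_eqF.
apply: (@le_trans _ _ ((4 * Num.sqrt 6)^-1 ^+ 2)).
  by rewrite ler_pXn2r// nnegrE ?invr_ge0 ?mulr_ge0 ?(ltW s0)// ltW// mulr_gt0// mulr_gt0.
by rewrite exprVn exprMn sqr_sqrtr// lef_pV2 ?posrE; lra.
Qed.

Let x := alpha * L * tau%:R ^+ 2.
Let x_gt0 : 0 < x.
Proof. by rewrite /x !mulr_gt0// ltr0n. Qed.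
Let x2 : x ^+ 2 <= 96^-1. Proof. exact: stepsize_sqr_le. Qed.

Let alphaL_le : alpha * L <= 8^-1.
Proof.
have : alpha * L <= x.
  rewrite -[leLHS]mulr1 /x ler_pM2l ?mulr_gt0//.
  by rewrite exprn_ege1.
have : x <= 8^-1 by move: x2 x_gt0; nra.
by move=> /[swap]; apply: le_trans.
Qed.

Lemma sum_deviation_le T : (tau <= T)%N ->
  \sum_(k < T.+1) D k <= 3 / 2 * (\sum_(k < tau.+1) D k
    + 16 * alpha ^+ 4 * tau%:R ^+ 4 * L ^+ 2 * n%:R *
        (\sum_(k < T.+1) G k + T.+1%:R * (sigma ^+ 2 / n%:R))
    + T.+1%:R * (64 * n%:R * tau%:R ^+ 3 * alpha ^+ 2 * sigma ^+ 2)).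
Proof.
move=> tT; set SD := \sum_(k < T.+1) D k; set SG := \sum_(k < T.+1) G k.
set N := 64 * _ * _ * _ * _; set S0 := \sum_(k < tau.+1) D k; set s := sigma ^+ 2 / _.
pose c := 4 * alpha ^+ 2 * tau%:R ^+ 2 * L ^+ 2.
have dev_rec k : (tau <= k)%N ->
    D k <= c * (\sum_(m < (2 * tau).-1 | (m < k)%N) m%:R * incr (k - m).-1) + N.
  exact: deviation_rec.
have c0 : 0 <= c.
  rewrite /c; apply: mulr_ge0 (sqr_ge0 _); apply: mulr_ge0 (sqr_ge0 _).
  by apply: mulr_ge0 (sqr_ge0 _).
have N0 : 0 <= N.
  rewrite /N; apply: mulr_ge0 (sqr_ge0 _); apply: mulr_ge0 (sqr_ge0 _).
  by apply: mulr_ge0 => //; apply: exprn_ge0.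
have incrS : \sum_(j < T) incr j <= 4 * SD + 2 * n%:R * alpha ^+ 2 * (SG + T.+1%:R * s).
  have s0 : 0 <= s by rewrite /s divr_ge0// sqr_ge0.
  have -> : \sum_(j < T) incr j = 2 * (\sum_(j < T) D j.+1) + 2 * (\sum_(j < T) D j)
      + 2 * n%:R * alpha ^+ 2 * (\sum_(j < T) G j + T%:R * s).
    rewrite (_ : T%:R * s = \sum_(j < T) s); last first.
      by rewrite sumr_const card_ord mulr_natl.
    rewrite -[\sum_(j < T) G j + _]big_split/= !mulr_sumr -!big_split/=.
    by apply: eq_bigr => j _; rewrite /incr -/s; ring.
  have h1 : \sum_(j < T) D j.+1 <= SD by rewrite /SD big_ord_recl lerDr.
  have h2 : \sum_(j < T) D j <= SD by rewrite /SD big_ord_recr lerDl.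
  have h3 : \sum_(j < T) G j <= SG by rewrite /SG big_ord_recr lerDl.
  have h4 : T%:R * s <= T.+1%:R * s by rewrite ler_wpM2r// ler_nat.
  have h5 : 0 <= 2 * n%:R * alpha ^+ 2 by apply: mulr_ge0 (sqr_ge0 _).
  have := ler_wpM2l h5 (lerD h3 h4); lra.
(* After the sums are exchanged, each increment is counted at most once per lag [m], with weight
   [m]; the lags sum to at most [2 * tau%:R ^+ 2]. *)
have window : \sum_(k < T.+1) \sum_(m < (2 * tau).-1 | (m < k)%N) m%:R * incr (k - m).-1
    <= 2 * tau%:R ^+ 2 * \sum_(j < T) incr j.
  rewrite (exchange_big_dep xpredT)//=.
  apply: (@le_trans _ _ (\sum_(m < (2 * tau).-1) m%:R * \sum_(j < T) incr j)).
    apply: ler_sum => m _; rewrite -mulr_sumr ler_wpM2l//.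
    exact: sum_shift_le.
  rewrite -mulr_suml ler_wpM2r//; first exact: sumr_ge0.
  apply: le_trans (sum_nat_le _) _.
  have h : (2 * tau).-1%:R <= 2 * tau%:R :> R by rewrite -natrM ler_nat leq_pred.
  have h0 : 0 <= (2 * tau).-1%:R :> R by [].
  nra.
have main : SD <= S0 + c * (2 * tau%:R ^+ 2 * \sum_(j < T) incr j) + T.+1%:R * N.
  (* The recursion is available only from [tau] on; the earlier terms are paid for by [S0]. *)
  apply: (@le_trans _ _ (\sum_(k < T.+1) ((if (k < tau)%N then D k else 0) +
    (c * (\sum_(m < (2 * tau).-1 | (m < k)%N) m%:R * incr (k - m).-1) + N)))).
    apply: ler_sum => k _; case: ltnP => [kt|tk]; last by rewrite add0r dev_rec.
    rewrite lerDl addr_ge0// mulr_ge0// sumr_ge0// => m _.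
    by rewrite mulr_ge0.
  rewrite big_split/= big_split/= addrA.
  apply: lerD; last by rewrite sumr_const card_ord mulr_natl.
  apply: lerD; last by rewrite -mulr_sumr ler_wpM2l.
  rewrite -big_mkcond/= /S0 [leRHS]big_ord_recr/= ler_wpDr//.
  rewrite (big_ord_widen_cond T.+1 xpredT D)//; exact: leqW.
have cE : c * (2 * tau%:R ^+ 2) = 8 * x ^+ 2 by rewrite /c /x; ring.
(* The coefficient of [SD] is [4 * 8 * x ^+ 2], at most one third; moving it to the left costs the
   factor 3 / 2. *)
have cS : c * (2 * tau%:R ^+ 2) * \sum_(j < T) incr j <= 3^-1 * SD
   + 16 * alpha ^+ 4 * tau%:R ^+ 4 * L ^+ 2 * n%:R * (SG + T.+1%:R * s).
  apply: le_trans (ler_wpM2l _ incrS) _; first by rewrite cE mulr_ge0 ?sqr_ge0.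
  rewrite mulrDr; apply: lerD; last first.
    by rewrite le_eqVlt; apply/orP; left; apply/eqP; rewrite /c; ring.
  have SD0 : 0 <= SD by exact: sumr_ge0.
  by rewrite cE; move: x2; nra.
by rewrite mulrA in main; lra.
Qed.

(** Telescoping leaves [SH + 3 / 4 * SG] on the left, since [alpha * L] is at most 1 / 8. The
    deviations give back at most a quarter of [SG], so [SH + SG / 2] is bounded, and doubling yields
    the constants: 4 and 4 from the descent, 3, 48 and 192 as twice 3 / 2 times 1, 16 and 64. *)
Lemma sum_gradients_le T : (tau <= T)%N ->
  T.+1%:R^-1 * \sum_(k < T.+1) (G k + H k) <=
    (4 * Delta 0) / (alpha * T%:R)
    + (3 * \sum_(k < tau.+1) D k) * L ^+ 2 / (n%:R * T%:R)
    + 48 * alpha ^+ 4 * tau%:R ^+ 4 * L ^+ 4 * sigma ^+ 2 / n%:R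
    + 192 * alpha ^+ 2 * tau%:R ^+ 3 * L ^+ 2 * sigma ^+ 2
    + 4 * alpha * L * sigma ^+ 2 / n%:R.
Proof.
move=> tT; have := sum_deviation_le tT.
set SD := \sum_(k < T.+1) D k; set SG := \sum_(k < T.+1) G k.
set S0 := \sum_(k < tau.+1) D k; set s := sigma ^+ 2 / n%:R.
pose SH := \sum_(k < T.+1) H k.
have SG0 : 0 <= SG by exact: sumr_ge0.
have SH0 : 0 <= SH by exact: sumr_ge0.
have S00 : 0 <= S0 by exact: sumr_ge0.
have s0 : 0 <= s by rewrite /s divr_ge0// sqr_ge0.
move=> SDle.
have telescope K : Delta K <= Delta 0 - alpha / 2 * (\sum_(k < K) H k)
    - alpha / 2 * (1 - 2 * alpha * L) * (\sum_(k < K) G k)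
    + alpha * L ^+ 2 / (2 * n%:R) * (\sum_(k < K) D k) + K%:R * (L * alpha ^+ 2 * s).
  elim: K => [|K IH]; first by rewrite !big_ord0 !mulr0 mul0r !subr0 !addr0.
  rewrite !big_ord_recr /= -(natr1 K) mulrDl mul1r.
  have := descent_rec K; rewrite -[_ * _ / n%:R]mulrA -/s; lra.
have h1 : alpha / 2 * SH + alpha / 2 * (1 - 2 * alpha * L) * SG <=
    Delta 0 + alpha * L ^+ 2 / (2 * n%:R) * SD + T.+1%:R * (L * alpha ^+ 2 * s).
  have := le_trans (Delta_ge0 _) (telescope T.+1); rewrite -/SD -/SG -/SH; lra.
have h2 : SH + 3 / 4 * SG <= 2 * (Delta 0 / alpha) + L ^+ 2 / n%:R * SD
    + T.+1%:R * (2 * L * alpha * s).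
  rewrite -(ler_pM2l (_ : 0 < alpha / 2)); last by rewrite divr_gt0.
  rewrite (_ : alpha / 2 * (2 * (Delta 0 / alpha) + _ + _) =
    Delta 0 + alpha * L ^+ 2 / (2 * n%:R) * SD + T.+1%:R * (L * alpha ^+ 2 * s)); last first.
    by field; rewrite !gt_eqF.
  apply: le_trans h1; rewrite mulrDr lerD2l.
  rewrite [leLHS](_ : _ = alpha / 2 * (3 / 4) * SG); last by ring.
  rewrite ler_wpM2r// ler_pM2l ?divr_gt0//; move: alphaL_le; lra.
have h3 : L ^+ 2 / n%:R * SD <= 3 / 2 * (S0 * L ^+ 2 / n%:R) + 4^-1 * SG
    + T.+1%:R * (24 * alpha ^+ 4 * tau%:R ^+ 4 * L ^+ 4 * s
       + 96 * alpha ^+ 2 * tau%:R ^+ 3 * L ^+ 2 * sigma ^+ 2).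
  apply: le_trans (ler_wpM2l _ SDle) _; first by rewrite divr_ge0 ?sqr_ge0.
  rewrite [leLHS](_ : _ = 3 / 2 * (S0 * L ^+ 2 / n%:R)
    + 24 * (alpha ^+ 4 * tau%:R ^+ 4 * L ^+ 4) * SG
    + T.+1%:R * (24 * alpha ^+ 4 * tau%:R ^+ 4 * L ^+ 4 * s
       + 96 * alpha ^+ 2 * tau%:R ^+ 3 * L ^+ 2 * sigma ^+ 2)); last first.
    by field; rewrite !gt_eqF.
  rewrite lerD2r lerD2l ler_wpM2r//.
  have : alpha ^+ 4 * tau%:R ^+ 4 * L ^+ 4 <= x ^+ 2 * x ^+ 2.
    rewrite /x [leRHS](_ : _ = alpha ^+ 4 * tau%:R ^+ 4 * L ^+ 4 * tau%:R ^+ 4); last by ring.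
    by rewrite ler_peMr ?mulr_ge0 ?exprn_ge0 ?(ltW alpha_gt0) ?(ltW L_gt0)// exprn_ege1.
  have := sqr_ge0 x; move: x2; nra.
have T0 : 0 < T%:R :> R by rewrite ltr0n (leq_trans tau_gt0).
have T1 : 0 < T.+1%:R :> R by rewrite ltr0n.
have TT : T%:R <= T.+1%:R :> R by rewrite ler_nat.
have h4 : SG + SH <= T.+1%:R * ((4 * Delta 0) / (alpha * T%:R)
    + (3 * S0) * L ^+ 2 / (n%:R * T%:R)
    + 48 * alpha ^+ 4 * tau%:R ^+ 4 * L ^+ 4 * s
    + 192 * alpha ^+ 2 * tau%:R ^+ 3 * L ^+ 2 * sigma ^+ 2 + 4 * alpha * L * s).
  (* The average is over [T.+1] terms while the bound divides by [T], so the ratio [T.+1 / T], at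
     least one, is given away. *)
  have q1 : 4 * (Delta 0 / alpha) <= T.+1%:R * (4 * Delta 0 / (alpha * T%:R)).
    rewrite [leRHS](_ : _ = 4 * (Delta 0 / alpha) * (T.+1%:R / T%:R)); last first.
      by field; rewrite !gt_eqF.
    apply: ler_peMr; last by rewrite ler_pdivlMr// mul1r.
    by apply: mulr_ge0 => //; apply: divr_ge0 => //; exact: ltW.
  have q2 : 3 * (S0 * L ^+ 2 / n%:R) <= T.+1%:R * (3 * S0 * L ^+ 2 / (n%:R * T%:R)).
    rewrite [leRHS](_ : _ = 3 * (S0 * L ^+ 2 / n%:R) * (T.+1%:R / T%:R)); last first.
      by field; rewrite !gt_eqF.
    apply: ler_peMr; last by rewrite ler_pdivlMr// mul1r.
    by apply: mulr_ge0 => //; apply: divr_ge0 => //; apply: mulr_ge0 (sqr_ge0 _).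
  rewrite !mulrDr in h3 *; lra.
rewrite big_split/= -/SG -/SH mulrC ler_pdivrMr// mulrC.
by rewrite -![_ * sigma ^+ 2 / n%:R]mulrA -/s.
Qed.

End recursions.

(** * Unrolling gradient tracking *)

Section tracking.
Context {R : realType} {n d : nat} (tau : nat) (W : nat -> 'M[R]_n) (alpha : R).
Hypotheses (n_gt0 : (0 < n)%N) (tau_gt0 : (0 < tau)%N) (W_ftc : finite_time_consensus tau W).
Variables x g y : nat -> 'M[R]_(n, d).
Hypothesis x_rec : forall k, x k.+1 = W (k %% tau)%N *m (x k - alpha *: g k).
Hypothesis g_rec : forall k, g k.+1 = W (k %% tau)%N *m g k + y k.+1 - y k.
Hypothesis g_init : g 0%N = y 0%N.

Let Phi := transition tau W.

(** The tracking invariant: mixing preserves the mean, and the increments of [y] telescope. *)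
Lemma row_mean_tracker k : row_mean (g k) = row_mean (y k).
Proof.
elim: k => [|k IH]; first by rewrite g_init.
rewrite g_rec row_meanB row_meanD row_mean_mul ?IH; last exact: doubly_stochastic_cycled.
by rewrite addrAC addrN add0r.
Qed.

Lemma row_mean_iterate k : row_mean (x k.+1) = row_mean (x k) - alpha *: row_mean (y k).
Proof.
rewrite x_rec row_mean_mul; last exact: doubly_stochastic_cycled.
by rewrite row_meanB row_meanZ row_mean_tracker.
Qed.

(** The increment from [k0 + j] to [k0 + j + 1] enters [g] at the latter step and is subtracted from
    [x] at each later step before [k0 + t], hence [t - j.+1] times. As [x] and [g] are multiplied by
    the same matrices, all these copies carry the same product. *)
Lemma unroll k0 t :
  g (k0 + t)%N = Phi k0 t *m g k0 +
    \sum_(j < t) Phi (k0 + j).+1 (t - j.+1) *m (y (k0 + j).+1 - y (k0 + j)%N) /\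
  x (k0 + t)%N = Phi k0 t *m (x k0 - (t%:R * alpha) *: g k0) -
    alpha *: \sum_(j < t) (t - j.+1)%:R *:
      (Phi (k0 + j).+1 (t - j.+1) *m (y (k0 + j).+1 - y (k0 + j)%N)).
Proof.
pose inc j := y (k0 + j).+1 - y (k0 + j)%N.
elim: t => [|t [IHg IHx]].
  by rewrite addn0 !big_ord0 !mul1mx mul0r scale0r scaler0 !subr0 addr0.
have PhiS (j : 'I_t) : W ((k0 + t) %% tau)%N *m (Phi (k0 + j).+1 (t - j.+1) *m inc j) =
    Phi (k0 + j).+1 (t.+1 - j.+1) *m inc j.
  rewrite mulmxA subSS -(subnSK (ltn_ord j)); congr (_ *m _).
  rewrite [RHS]/=; congr (W (_ %% tau)%N *m _).
  by rewrite addSnnS subnSK// -addnA subnKC// ltnW.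
have sumS (c : 'I_t -> R) :
    W ((k0 + t) %% tau)%N *m (\sum_(j < t) c j *: (Phi (k0 + j).+1 (t - j.+1) *m inc j)) =
    \sum_(j < t) c j *: (Phi (k0 + j).+1 (t.+1 - j.+1) *m inc j).
  by rewrite mulmx_sumr; apply: eq_bigr => j _; rewrite -scalemxAr PhiS.
rewrite addnS g_rec x_rec IHg IHx; split.
  rewrite big_ord_recr/= subnn mul1mx mulmxDr -!addrA; congr (_ + _); first by rewrite mulmxA.
  by rewrite mulmx_sumr; congr (_ + _); apply: eq_bigr => j _; exact: PhiS.
(* The newest increment has weight zero in [x]; each older weight grows by one, the extra copy
   coming from [alpha *: g]. *)
have -> : \sum_(j < t.+1) (t.+1 - j.+1)%:R *: (Phi (k0 + j).+1 (t.+1 - j.+1) *m inc j) =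
    \sum_(j < t) (t - j.+1)%:R *: (Phi (k0 + j).+1 (t.+1 - j.+1) *m inc j) +
    \sum_(j < t) 1 *: (Phi (k0 + j).+1 (t.+1 - j.+1) *m inc j).
  rewrite big_ord_recr/= subnn scale0r addr0 -big_split; apply: eq_bigr => j _ /=.
  by rewrite -scalerDl natr1 -subSn ?ltn_ord.
rewrite -!sumS; under [in LHS]eq_bigr do rewrite -/(inc _).
under [X in - (alpha *: X)]eq_bigr do rewrite -/(inc _).
set A := \sum_(j < t) (t - j.+1)%:R *: _; set B := \sum_(j < t) _ *m _.
have -> : \sum_(j < t) 1 *: (Phi (k0 + j).+1 (t - j.+1) *m inc j) = B.
  by apply: eq_bigr => j _; rewrite scale1r.
rewrite -mulmxDr scalemxAr [Phi k0 t.+1]/= -mulmxA -mulmxBr; congr (_ *m _).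
rewrite -(natr1 t) mulrDl mul1r scalerDl opprD !scalerDr mulmxBr !addrA mulmxBr mulmxBr.
rewrite -!scalemxAr !opprD !addrA.
congr (_ - _); exact: addrAC.
Qed.

(* Number of steps from the start of the block preceding that of k; it contains
   one full aligned block, over which the mixing matrices average exactly. *)
Definition window k : nat := (tau + k %% tau)%N.

Lemma window_le k : (window k <= (2 * tau).-1)%N.
Proof. by rewrite /window mul2n -addnn -ltnS prednK ?addn_gt0 ?tau_gt0// ltn_add2l ltn_mod. Qed.

Let window_start k : (tau <= k)%N -> ((k %/ tau).-1 * tau + window k = k)%N.
Proof.
by move=> tk; rewrite /window addnA -mulSnr prednK ?divn_gt0// -divn_eq.
Qed.

Lemma window_leq k : (tau <= k)%N -> (window k <= k)%N.
Proof. by move=> /window_start kE; rewrite -[leqRHS]kE leq_addl. Qed.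

Lemma deviation_unroll k : (tau <= k)%N ->
  deviation (x k) = - alpha *: \sum_(m < window k) m%:R *:
     deviation (Phi (k - m) m *m (y (k - m)%N - y (k - m).-1)).
Proof.
move=> tk; set t := window k; pose k0 := ((k %/ tau).-1 * tau)%N.
have kE : (k0 + t = k)%N by exact: window_start.
rewrite -[in LHS]kE; have [_ ->] := unroll k0 t.
rewrite deviationB deviationZ [X in deviation (X *m _)](_ : _ = const_mx n%:R^-1); last first.
  by rewrite /t; apply: transition_consensus => //; exact: dvdn_mull.
rewrite deviation_average sub0r scaleNr; congr (- (_ *: _)).
(* After reversal, [m] is both the weight of an increment and the number of mixing steps that it has
   undergone. *)
rewrite deviation_sum (reindex_inj rev_ord_inj)/=; apply: eq_bigr => m _.
rewrite deviationZ.
have mt := ltn_ord m.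
have -> : (t - (t - m.+1).+1 = m)%N by rewrite subnSK// subKn// ltnW.
have e : (k0 + (t - m.+1)).+1 = (k - m)%N.
  by rewrite -kE -addnS subnSK// addnBA// ltnW.
by rewrite e -e.
Qed.

Variables (p : nat -> 'M[R]_(n, d)) (L : R).
Hypothesis p_lip : forall k l, sqnorm (p k - p l) <= L ^+ 2 * sqnorm (x k - x l).

Let s k := y k - p k.

Definition increment_bound j := 2 * sqnorm (deviation (x j.+1)) + 2 * sqnorm (deviation (x j))
  + n%:R * alpha ^+ 2 * (2 * sqnorm (row_mean (p j)) + 2 * sqnorm (row_mean (s j))).

(** Pythagoras splits the step into its deviation and [n] times its mean; the mean moves by
    [- alpha] times the mean of [y], that is, of true gradients plus noise. *)
Lemma iterate_increment j : sqnorm (x j.+1 - x j) <= increment_bound j.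
Proof.
rewrite sqnorm_deviation// deviationB row_meanB row_mean_iterate.
rewrite [_ - _ - row_mean (x j)]addrAC subrr add0r.
rewrite sqnormN sqnormZ mulrA; apply: lerD; first exact: sqnormB_le.
rewrite ler_wpM2l//; first exact: mulr_ge0 (sqr_ge0 _).
by rewrite -[y j](subrK (p j)) -/(s j) row_meanD [leRHS]addrC sqnormD_le.
Qed.

(** The gradient increments are estimated at once by Cauchy-Schwarz with weights [m] and the
    Lipschitz bound. The noise stays inside the norm, as one sum for times [k - m] and one for times
    [(k - m).-1], until expectations can exploit that it is uncorrelated. *)
Lemma deviation_sqnorm_le k : (tau <= k)%N ->
  sqnorm (deviation (x k)) <=
    4 * alpha ^+ 2 * tau%:R ^+ 2 * L ^+ 2 *
      (\sum_(m < window k) m%:R * increment_bound (k - m).-1)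
    + 4 * alpha ^+ 2 *
      (sqnorm (\sum_(m < window k) m%:R *: (Phi (k - m) m *m s (k - m)%N))
       + sqnorm (\sum_(m < window k) m%:R *: (Phi (k - m) m *m s (k - m).-1))).
Proof.
move=> tk; rewrite deviation_unroll// sqnormZ sqrrN.
set t := window k.
pose A := \sum_(m < t) m%:R *: deviation (Phi (k - m) m *m (p (k - m)%N - p (k - m).-1)).
pose N1 := \sum_(m < t) m%:R *: (Phi (k - m) m *m s (k - m)%N).
pose N2 := \sum_(m < t) m%:R *: (Phi (k - m) m *m s (k - m).-1).
rewrite (_ : \sum_(m < t) _ = A + deviation (N1 - N2)); last first.
  rewrite /A /N1 /N2 -sumrB deviation_sum -big_split; apply: eq_bigr => m _ /=.
  rewrite -scalerBr -mulmxBr deviationZ -scalerDr -deviationD -mulmxDr.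
  congr (_ *: deviation (_ *m _)); rewrite /s.
  by apply/matrixP => i j; rewrite !mxE; ring.
have A_le : sqnorm A <= 2 * tau%:R ^+ 2 *
    (L ^+ 2 * \sum_(m < t) m%:R * increment_bound (k - m).-1).
  apply: le_trans (sqnorm_weighted_sum_le _ _ _) _; first by [].
  apply: ler_pM => //; first exact: sumr_ge0.
  - by apply: sumr_ge0 => m _; rewrite mulr_ge0// sqnorm_ge0.
  - apply: le_trans (sum_nat_le _) _.
    have h : t%:R <= 2 * tau%:R :> R.
      by rewrite -natrM ler_nat (leq_trans (window_le k))// leq_pred.
    have h0 : 0 <= t%:R :> R by [].
    nra.
  - rewrite mulr_sumr; apply: ler_sum => m _; rewrite mulrCA ler_wpM2l//.
    apply: le_trans (sqnorm_deviation_le _ n_gt0) _.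
    apply: le_trans (doubly_stochastic_contraction _ _) _.
      exact: doubly_stochastic_transition.
    apply: le_trans (p_lip _ _) _; rewrite ler_wpM2l ?sqr_ge0//.
    have mk : (m < k)%N by exact: leq_trans (ltn_ord m) (window_leq tk).
    have {1}-> : (k - m = (k - m).-1.+1)%N by rewrite prednK// subn_gt0.
    exact: iterate_increment.
apply: (@le_trans _ _ (alpha ^+ 2 * (2 * sqnorm A + 2 * (2 * sqnorm N1 + 2 * sqnorm N2)))).
  rewrite ler_wpM2l ?sqr_ge0//; apply: le_trans (sqnormD_le _ _) _; rewrite lerD2l.
  rewrite ler_wpM2l//; apply: le_trans (sqnorm_deviation_le _ n_gt0) _.
  exact: sqnormB_le.
have := ler_wpM2l (sqr_ge0 alpha) A_le; lra.
Qed.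

End tracking.

(** * The gradient noise *)

Section measurable_matrices.
Context {R : realType} {dS : measure_display} {S : measurableType dS}.

Definition mx_measurable {m p} (X : S -> 'M[R]_(m, p)) :=
  forall i j, measurable_fun setT (fun w => X w i j).

Lemma mx_measurableD {m p} (X Y : S -> 'M[R]_(m, p)) :
  mx_measurable X -> mx_measurable Y -> mx_measurable (fun w => X w + Y w).
Proof. by move=> mX mY i j; under eq_fun do rewrite mxE; exact: measurable_funD. Qed.

Lemma mx_measurable_linear {m p m' p'} (u : {linear 'M[R]_(m, p) -> 'M[R]_(m', p')})
    (X : S -> 'M[R]_(m, p)) : mx_measurable X -> mx_measurable (fun w => u (X w)).
Proof.
move=> mX i j.
rewrite (_ : (fun w => _) =
    fun w => \sum_k \sum_l u (delta_mx k l) i j * X w k l).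
  apply: measurable_sum => k; apply: measurable_sum => l.
  exact: measurable_funM.
apply/funext => w; rewrite [X w in LHS]matrix_sum_delta linear_sum summxE.
apply: eq_bigr => k _; rewrite linear_sum summxE; apply: eq_bigr => l _.
by rewrite linearZ mxE mulrC.
Qed.

Lemma mx_measurableB {m p} (X Y : S -> 'M[R]_(m, p)) :
  mx_measurable X -> mx_measurable Y -> mx_measurable (fun w => X w - Y w).
Proof.
move=> mX mY; apply: mx_measurableD => //.
exact: (mx_measurable_linear (-%R)).
Qed.

Lemma continuous_mx_measurable {d} (h : 'rV[R]_d -> R) (X : S -> 'rV[R]_d) :
  continuous (h : 'rV[R]_d -> R^o) -> mx_measurable X ->
  measurable_fun setT (fun w => h (X w)).
Proof.
move=> ch mX.
exact: (separately_measurable_comp (F := fun y (_ : S) => h y) (z := id)).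
Qed.

End measurable_matrices.

Section noise.
Context {R : realType} {n d : nat} {dX : 'I_n -> measure_display}
  {Xi : forall i, measurableType (dX i)}.
Context (F : forall i, 'rV[R]_d -> Xi i -> R).
Hypothesis F_meas : forall i x, measurable_fun setT (@F i x).
Hypothesis F_diff : forall i z x,
  differentiable ((fun y => @F i y z) : 'rV[R]_d -> R^o) x.
Context {dP : measure_display} {Om : measurableType dP} (P : probability Om R).
Variables (x0 : Om -> 'M[R]_(n, d)) (xi : forall i, nat -> {mfun Om >-> Xi i}).
Variables (tau : nat) (W : nat -> 'M[R]_n) (alpha : R).

Let x := gt_ft_x F xi tau W alpha x0.
Let y k w := stoch_grad F xi k w (x k w).

(** The iterate at step [k] involves samples strictly before [k], the tracker also those at [k]; the
    induction carries both claims. The map [e] allows [Om] to be equipped with another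
    sigma-algebra. *)
Lemma gt_ft_measurable {dS} {S : measurableType dS} (e : S -> Om) k :
  mx_measurable (fun w => x0 (e w)) ->
  (forall i l, (l < k)%N -> measurable_fun setT (fun w => xi i l (e w))) ->
  mx_measurable (fun w => x k (e w)).
Proof.
move=> mx0.
have my l : mx_measurable (fun w => x l (e w)) ->
    (forall i, measurable_fun setT (fun w => xi i l (e w))) ->
    mx_measurable (fun w => y l (e w)).
  move=> mx mxi i c.
  rewrite (_ : (fun w => _) = fun w =>
      grad (fun v => @F i v (xi i l (e w))) (row i (x l (e w))) 0 c).
    apply: grad_measurable => // j.
    by under eq_fun do rewrite mxE; exact: mx.
  by apply/funext => w; rewrite /y /stoch_grad mxE.
suff : ((forall i l, (l < k)%N -> measurable_fun setT (fun w => xi i l (e w))) ->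
    mx_measurable (fun w => x k (e w))) /\
  ((forall i l, (l <= k)%N -> measurable_fun setT (fun w => xi i l (e w))) ->
    mx_measurable (fun w => (gt_ft F xi tau W alpha x0 k (e w)).2)) by case.
have xS l w : x l.+1 w = W (l %% tau)%N *m
    (x l w - alpha *: (gt_ft F xi tau W alpha x0 l w).2).
  by rewrite /x /gt_ft_x/=; case: gt_ft.
have gS l w : (gt_ft F xi tau W alpha x0 l.+1 w).2 =
    W (l %% tau)%N *m (gt_ft F xi tau W alpha x0 l w).2 + y l.+1 w - y l w.
  by rewrite /y xS /x /gt_ft_x/=; case: gt_ft.
elim: k => [|k [IHx IHg]].
  by split=> // mxi; apply: (my 0%N) => // i; exact: mxi.
have xk1 : (forall i l, (l < k.+1)%N -> measurable_fun setT (fun w => xi i l (e w))) ->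
    mx_measurable (fun w => x k.+1 (e w)).
  move=> mxi; under eq_fun do rewrite xS.
  apply: (mx_measurable_linear (mulmx (W (k %% tau)%N))).
  apply: mx_measurableB; first by apply: IHx => i l lk; apply: mxi; exact: ltnW.
  by apply: (mx_measurable_linear ( *:%R alpha)); exact: IHg.
split=> // mxi; under eq_fun do rewrite gS.
apply: mx_measurableB.
  apply: mx_measurableD.
    apply: (mx_measurable_linear (mulmx (W (k %% tau)%N))).
    by apply: IHg => i l lk; apply: mxi; exact: leqW.
  apply: my => [|i]; last exact: mxi.
  by apply: xk1 => i l lk; apply: mxi; exact: ltnW.
apply: my => [|i]; last exact: mxi.
by apply: IHx => i l lk; apply: mxi; exact: leqW (ltnW lk).
Qed.

Variable f : 'I_n -> 'rV[R]_d -> R.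
Hypothesis f_C1 : forall i, continuously_differentiable (f i).
Hypothesis x0_meas : mx_measurable x0.
Hypothesis xi_indep : mutually_independent P (sampling_sigma xi x0).
Hypothesis unbiased : forall k i c, is_cond_expectation P (history x k)
  (fun w => y k w i c) (fun w => grad (f i) (row i (x k w)) 0 c).

Definition true_grad (X : 'M[R]_(n, d)) : 'M[R]_(n, d) := \matrix_i grad (f i) (row i X).

Definition noise k w := y k w - true_grad (x k w).

Lemma true_grad_measurable {dS} {S : measurableType dS} (X : S -> 'M[R]_(n, d)) :
  mx_measurable X -> mx_measurable (fun w => true_grad (X w)).
Proof.
move=> mX i c.
have cg : continuous ((fun v => grad (f i) v 0 c) : 'rV[R]_d -> R^o).
  move=> v; exact: (cvg_comp _ _ ((f_C1 i).2 v) (@coord_continuous R 1 d 0 c (grad (f i) v))).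
rewrite (_ : (fun w => _) = fun w => (fun v => grad (f i) v 0 c) (row i (X w))).
  apply: (continuous_mx_measurable cg) => i' j.
  by under eq_fun do rewrite mxE; exact: mX.
by apply/funext => w; rewrite mxE.
Qed.

Lemma noiseE k w i c : noise k w i c =
  grad (fun v => @F i v (xi i k w)) (row i (x k w)) 0 c - grad (f i) (row i (x k w)) 0 c.
Proof. by rewrite /noise /y /stoch_grad !mxE. Qed.

Lemma noise_measurable {dS} {S : measurableType dS} (e : S -> Om) k i c :
  mx_measurable (fun w => x k (e w)) -> measurable_fun setT (fun w => xi i k (e w)) ->
  measurable_fun setT (fun w => noise k (e w) i c).
Proof.
move=> mx mxi; under eq_fun do rewrite noiseE; apply: measurable_funB.
  by apply: grad_measurable => // j; under eq_fun do rewrite mxE; exact: mx.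
have := true_grad_measurable mx i c.
by under eq_fun do rewrite mxE.
Qed.

Lemma iterate_measurable k : mx_measurable (x k).
Proof. exact: (gt_ft_measurable (e := id)). Qed.

Lemma history_sub k : history x k `<=` measurable.
Proof.
apply: smallest_sub; first exact: sigma_algebra_measurable.
move=> _ [j [a [b [B [mB ->]]]]]; rewrite -[X in measurable X]setTI.
exact: iterate_measurable.
Qed.

Lemma noise_summable k i c : P.-integrable setT (fun w => (noise k w i c)%:E).
Proof.
have [iX iY _ _] := unbiased k i c.
have := integrableB measurableT iX iY; apply: eq_integrable => // w _.
by rewrite /= /noise !mxE.
Qed.

Lemma noise_history k i c A : history x k A ->
  (\int[P]_(w in A) (noise k w i c)%:E = 0)%E.
Proof.
move=> hA; have mA := history_sub hA.
have [iX iY _ XY] := unbiased k i c.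
under eq_integral do rewrite /noise mxE [(- true_grad _) _ _]mxE [true_grad _ _ _]mxE EFinB.
rewrite integralB// ?XY ?subee//.
- by apply: integrable_fin_num => //; exact: integrableS iX.
- exact: integrableS iX.
- exact: integrableS iY.
Qed.

Let sampling_sub q : sampling_sigma xi x0 q `<=` measurable.
Proof.
case: q => [[i k]|] /=.
  by move=> _ [B mB <-]; exact: measurable_funP.
apply: smallest_sub; first exact: sigma_algebra_measurable.
move=> _ [j [a [b [B [mB ->]]]]]; rewrite -[X in measurable X]setTI.
exact: x0_meas.
Qed.

Let sampling_setT q : sampling_sigma xi x0 q setT.
Proof.
case: q => [[i k]|] /=; first by exists setT => //; rewrite preimage_setT setIT.
exact: (@measurableT _ (g_sigma_algebraType _)).
Qed.

Let sampling_setI q : setI_closed (sampling_sigma xi x0 q).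
Proof.
case: q => [[i k]|] /=.
  move=> _ _ [A mA <-] [B mB <-]; exists (A `&` B); first exact: measurableI.
  by rewrite !setTI preimage_setI.
by move=> A B mA mB; exact: (@measurableI _ (g_sigma_algebraType _)).
Qed.

(** The sample space with the sigma-algebra of the initial point and of all samples but [q], later
    ones included. *)
Let past q := g_sigma_algebraType (others (sampling_sigma xi x0) (Some q)).

Lemma past_iterate_measurable i k l : (l <= k)%N ->
  mx_measurable (fun w : past (i, k) => x l w).
Proof.
move=> lk; apply: (gt_ft_measurable (S := past (i, k)) (e := id)) => [a b|j l' l'l].
  move=> _ B mB; rewrite setTI; apply: sub_sigma_algebra.
  apply: (others_sub (i := None)) => //; apply: sub_sigma_algebra.
  by exists tt, a, b, B.
move=> _ B mB; rewrite setTI; apply: sub_sigma_algebra.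
apply: (others_sub (i := Some (j, l'))).
  by apply/eqP => -[_ e]; rewrite e ltnNge lk in l'l.
by exists B => //; rewrite setTI.
Qed.

Lemma past_noise_measurable i k j l c : (l <= k)%N -> (j, l) != (i, k) ->
  measurable_fun setT (fun w : past (i, k) => noise l w j c).
Proof.
move=> lk jl; apply: (noise_measurable (S := past (i, k)) (e := id)).
  exact: past_iterate_measurable.
move=> _ B mB; rewrite setTI; apply: sub_sigma_algebra.
apply: (others_sub (i := Some (j, l))); first by [].
by exists B => //; rewrite setTI.
Qed.

(** The noise is a function of the independent pair formed by the outcome seen in [past (i, k)] and
    the sample [xi i k], so the orthogonality lemma for independent pairs applies. *)
Lemma noise_orthogonal i k c (V : Om -> R) :
  measurable_fun setT (V : past (i, k) -> R) ->
  P.-integrable setT (fun w => (V w * noise k w i c)%:E) ->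
  (\int[P]_w (V w * noise k w i c)%:E = 0)%E.
Proof.
move=> mV iVs.
have id_meas : measurable_fun setT (id : Om -> past (i, k)).
  move=> _ A mA; rewrite setTI.
  move: A mA; apply: smallest_sub; first exact: sigma_algebra_measurable.
  exact: (others_meas sampling_sub).
(* The identity, viewed as a random variable with values in the coarser space. *)
pose Y : {mfun Om >-> past (i, k)} :=
  HB.pack (id : Om -> past (i, k)) (isMeasurableFun.Build _ _ _ _ _ id_meas).
pose h (u : past (i, k) * Xi i) : R :=
  grad (fun v => @F i v u.2) (row i (x k u.1)) 0 c - grad (f i) (row i (x k u.1)) 0 c.
(* Kept general in [S]: it serves for the past and, below, for the sigma-algebra of the history. *)
have mh dS (S : measurableType dS) (e : S -> Om) : mx_measurable (fun w => x k (e w)) ->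
    measurable_fun setT (fun u : S * Xi i =>
      grad (fun v => @F i v u.2) (row i (x k (e u.1))) 0 c
      - grad (f i) (row i (x k (e u.1))) 0 c).
  move=> mx; have mx' : mx_measurable (fun u : S * Xi i => x k (e u.1)).
    by move=> a b; exact: (measurableT_comp (mx a b) measurable_fst).
  apply: measurable_funB.
    by apply: grad_measurable => // j; under eq_fun do rewrite mxE; exact: mx'.
  by have := true_grad_measurable mx' i c; under eq_fun do rewrite mxE.
have hE w : h (Y w, xi i k w) = noise k w i c by rewrite noiseE.
have ind A B : measurable A -> measurable B ->
    (P (Y @^-1` A `&` xi i k @^-1` B) = P (Y @^-1` A) * P (xi i k @^-1` B))%E.
  move=> mA mB; apply: (others_indep xi_indep sampling_sub sampling_setT sampling_setI
    (q := Some (i, k)) mA).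
  by exists B => //; rewrite setTI.
have := independent_orthogonal (Y := Y) (Z := xi i k) ind (h := h) (V := V).
under eq_integral do rewrite hE.
apply => //.
- exact: (mh _ (past (i, k)) id (past_iterate_measurable (leqnn k))).
- by under eq_fun do rewrite hE; exact: noise_summable.
- by under eq_fun do rewrite hE.
(* Integrating out the sample leaves a function of [x k], so the event lies in the history, over
   whose events the noise integrates to zero. *)
move=> D mD; under eq_integral do rewrite hE; apply: noise_history.
pose G := [set A | exists (j : 'I_k.+1) a b (B : set R),
  measurable B /\ A = (fun w => x j w a b) @^-1` B].
have mxk : mx_measurable (fun w : g_sigma_algebraType G => x k w).
  move=> a b _ B mB; rewrite setTI; apply: sub_sigma_algebra.
  by exists ord_max, a, b, B.
have := measurable_partial_integral (distribution P (xi i k))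
  (measurableT_comp (@EFin_measurable R setT) (mh _ (g_sigma_algebraType G) id mxk)).
by move=> /(_ measurableT D mD); rewrite setTI.
Qed.

End noise.

(** * Convergence *)

Section convergence.
Context {R : realType} {n d : nat} {dX : 'I_n -> measure_display}
  {Xi : forall i, measurableType (dX i)}.
Variable F : forall i, 'rV[R]_d -> Xi i -> R.
Hypothesis F_meas : forall i x, measurable_fun setT (@F i x).
Hypothesis F_diff : forall i z x,
  differentiable ((fun y => @F i y z) : 'rV[R]_d -> R^o) x.
Variable f : 'I_n -> 'rV[R]_d -> R.
Hypothesis f_C1 : forall i, continuously_differentiable (f i).
Variable L : R.
Hypotheses (n_gt0 : (0 < n)%N) (L_gt0 : 0 < L).
Hypothesis f_smooth : forall i x y,
  enorm (grad (f i) x - grad (f i) y) <= L * enorm (x - y).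
Let fbar := objective f.
Variable fstar : R.
Hypothesis fstar_le : forall x, fstar <= fbar x.
Variables (tau : nat) (W : nat -> 'M[R]_n) (alpha : R).
Hypotheses (tau_gt0 : (0 < tau)%N) (W_ftc : finite_time_consensus tau W)
  (alpha_gt0 : 0 < alpha).
Context {dP : measure_display} {Om : measurableType dP} (P : probability Om R).
Variables (x0 : Om -> 'M[R]_(n, d)) (xi : forall i, nat -> {mfun Om >-> Xi i}).
Hypothesis x0_meas : mx_measurable x0.
Hypothesis xi_indep : mutually_independent P (sampling_sigma xi x0).
Let x := gt_ft_x F xi tau W alpha x0.
Let y k w := stoch_grad F xi k w (x k w).
Hypothesis unbiased : forall k i c, is_cond_expectation P (history x k)
  (fun w => y k w i c) (fun w => grad (f i) (row i (x k w)) 0 c).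
Variable sigma : R.
Hypothesis bounded_var : forall k i, exists2 V : Om -> R,
  is_cond_expectation P (history x k)
    (fun w => enorm (row i (y k w) - grad (f i) (row i (x k w))) ^+ 2) V
  & {ae P, forall w, V w <= sigma ^+ 2}.

Let s k w : 'M[R]_(n, d) := noise F x0 xi tau W alpha f k w.
Let p k w := true_grad f (x k w).

Let nR_gt0 : 0 < n%:R :> R. Proof. by rewrite ltr0n. Qed.

Let x_meas k : mx_measurable (x k).
Proof. exact: iterate_measurable. Qed.

Let s_row k i w : row i (s k w) = row i (y k w) - grad (f i) (row i (x k w)).
Proof.
rewrite /s /noise linearB/=; congr (_ - _).
by apply/rowP => c; rewrite !mxE.
Qed.

Let s_meas k : mx_measurable (s k).
Proof.
by move=> i c; apply: (noise_measurable F_meas F_diff f_C1 (e := id)).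
Qed.

Let row_s_summable k i : summable_rv P (fun w => sqnorm (row i (s k w))).
Proof.
have [V [iX _ _ _] _] := bounded_var k i.
rewrite /summable_rv (_ : (fun w => sqnorm (row i (s k w))) =
  (fun w => enorm (row i (y k w) - grad (f i) (row i (x k w))) ^+ 2))//.
by apply/funext => w; rewrite enorm_sqr s_row.
Qed.

Let s_L2 k : L2mx P (s k).
Proof.
move=> i c; apply: (L2_le (s_meas k i c) _ (row_s_summable k i)) => w.
by have := sqnorm_entry (row i (s k w)) 0 c; rewrite mxE.
Qed.

Let row_s_mean k i : mean P (fun w => sqnorm (row i (s k w))) <= sigma ^+ 2.
Proof.
have [V [iX iV _ XV] Vle] := bounded_var k i.
have -> : mean P (fun w => sqnorm (row i (s k w))) = mean P V.
  rewrite /mean /Rintegral XV; last exact: (@measurableT _ (g_sigma_algebraType _)).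
  by congr fine; apply: eq_integral => w _; rewrite enorm_sqr s_row.
have mV : measurable_fun setT V by move/integrableP : iV => [/measurable_EFinP].
(* The bound on [V] holds only almost everywhere; the truncation [Num.min (V w) (sigma ^+ 2)] has
   the same mean and satisfies it everywhere. *)
have mU : measurable_fun setT (fun w => Num.min (V w) (sigma ^+ 2)).
  exact: measurable_minr.
have iU : summable_rv P (fun w => Num.min (V w) (sigma ^+ 2)).
  apply: (summable_rv_le (Y := fun w => `|V w| + sigma ^+ 2)) => [//|w|].
    have := ler_norm (V w); have := ler_norm (- V w); rewrite normrN.
    have := sqr_ge0 sigma; rewrite ler_norml minEle; case: ifP => _; lra.
  apply: summable_rvD; last exact: summable_rv_cst.
  by move/integrable_abse : iV.
have -> : mean P V = mean P (fun w => Num.min (V w) (sigma ^+ 2)).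
  congr fine; apply: ae_eq_integral => //.
  - exact/measurable_EFinP.
  - exact/measurable_EFinP.
  - by apply: filterS Vle => w Vw _; rewrite /= min_l.
rewrite -[leRHS](mean_cst P); apply: mean_le => // [|w].
  exact: summable_rv_cst.
by rewrite ge_min lexx orbT.
Qed.

Let s_past_mean k i c V : measurable_fun setT
    (V : g_sigma_algebraType (others (sampling_sigma xi x0) (Some (i, k))) -> R) ->
  L2 P V -> mean P (fun w => V w * s k w i c) = 0.
Proof.
move=> mV iV; rewrite /mean /Rintegral.
rewrite (noise_orthogonal F_meas F_diff f_C1 x0_meas xi_indep unbiased)//.
exact: L2_mul iV (s_L2 k i c).
Qed.

(** By symmetry [k] is the later time; the other noise term then does not involve the sample
    [(i, k)], also when the times coincide and the agents differ. *)
Let s_uncorrelated k l i j c : (i, k) != (j, l) ->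
  mean P (fun w => s k w i c * s l w j c) = 0.
Proof.
wlog lk : k l i j / (l <= k)%N.
  move=> h ij; have [lk|kl] := leqP l k; first exact: h.
  rewrite -[RHS](h l k j i (ltnW kl)) 1?eq_sym//.
  by congr mean; apply/funext => w; rewrite mulrC.
move=> ij; rewrite -[RHS](s_past_mean (i := i) (k := k) c _ (s_L2 l j c)).
  by congr mean; apply/funext => w; rewrite mulrC.
by apply: past_noise_measurable => //; rewrite eq_sym.
Qed.

Lemma mean_sqnorm_mean_noise k :
  mean P (fun w => sqnorm (row_mean (s k w))) <= sigma ^+ 2 / n%:R.
Proof.
have -> : (fun w => sqnorm (row_mean (s k w))) =
    fun w => sqnorm (\sum_(i < n) n%:R^-1 *: row i (s k w)).
  by apply/funext => w; rewrite -scaler_sumr.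
apply: le_trans (mean_sqnorm_uncorrelated _ _ _ (row_s_mean k)) _ => [i|i j c ij|].
- by move=> a c; under eq_fun do rewrite mxE; exact: s_L2.
- rewrite -[RHS](@s_uncorrelated k k i j c); last by apply: contra ij => /eqP[->].
  by congr mean; apply/funext => w; rewrite !mxE.
- rewrite sumr_const card_ord -[_ *+ n]mulr_natr le_eqVlt; apply/orP; left; apply/eqP.
  by field; rewrite gt_eqF.
Qed.

(** Row [i] combines the uncorrelated rows indexed by pairs [(m, j)] with weights [m%:R * A m i j].
    Summed over [i] and [j], the squared weights are at most [m%:R ^+ 2 * n%:R], and the squares of
    the lags sum to at most [t%:R ^+ 3]. Injectivity of [time] keeps distinct pairs from sharing a
    noise term. *)
Lemma mean_sqnorm_weighted_noise t (A : nat -> 'M[R]_n) (time : nat -> nat) :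
  (forall m, doubly_stochastic (A m)) ->
  (forall m m', (m < t)%N -> (m' < t)%N -> time m = time m' -> m = m') ->
  mean P (fun w => sqnorm (\sum_(m < t) m%:R *: (A m *m s (time m) w)))
    <= n%:R * t%:R ^+ 3 * sigma ^+ 2.
Proof.
move=> dsA time_inj.
pose a i (q : 'I_t * 'I_n) := q.1%:R * A q.1 i q.2.
pose Y (q : 'I_t * 'I_n) w := row q.2 (s (time q.1) w).
have YL2 q : L2mx P (Y q) by move=> ? c; under eq_fun do rewrite mxE; exact: s_L2.
have -> : (fun w => sqnorm (\sum_(m < t) m%:R *: (A m *m s (time m) w))) =
    fun w => \sum_i sqnorm (\sum_q a i q *: Y q w).
  apply/funext => w; rewrite sqnorm_row; apply: eq_bigr => i _; congr sqnorm.
  rewrite linear_sum -(pair_bigA _ (fun m j => a i (m, j) *: Y (m, j) w))/=.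
  apply: eq_bigr => m _; rewrite linearZ/= row_mul mulmx_sum_row scaler_sumr.
  by apply: eq_bigr => j _; rewrite mxE scalerA.
rewrite mean_sum; last first.
  by move=> i _; apply: sqnorm_summable; apply: L2mx_sum => q _; exact: L2mxZ.
apply: (@le_trans _ _ (\sum_i sigma ^+ 2 * \sum_q a i q ^+ 2)).
  apply: ler_sum => i _; apply: mean_sqnorm_uncorrelated => [//|q q' c qq'|q].
    rewrite -[RHS](@s_uncorrelated (time q.1) (time q'.1) q.2 q'.2 c).
      by congr mean; apply/funext => w; rewrite !mxE.
    apply: contra qq' => /eqP[e1 e2]; apply/eqP.
    case: q q' e1 e2 => [m j] [m' j'] /= -> e2; congr (_, _).
    by apply: val_inj; exact: (time_inj _ _ (ltn_ord m) (ltn_ord m') e2).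
  exact: row_s_mean.
rewrite -mulr_sumr mulrC ler_wpM2r ?sqr_ge0//.
rewrite exchange_big -(pair_bigA _ (fun m j => \sum_i a i (m, j) ^+ 2))/=.
apply: (@le_trans _ _ (\sum_(m < t) m%:R ^+ 2 * n%:R)).
  apply: ler_sum => m _.
  apply: le_trans (ler_wpM2l (sqr_ge0 _) (doubly_stochastic_sqnorm_le (dsA m))).
  rewrite /sqnorm exchange_big mulr_sumr; apply: ler_sum => j _ /=.
  by rewrite mulr_sumr; apply: ler_sum => i _; rewrite /a/= exprMn.
by rewrite -mulr_suml mulrC ler_wpM2l// sum_sqr_nat_le.
Qed.

Let f_diff i z : differentiable (f i : 'rV[R]_d -> R^o) z.
Proof. exact: (f_C1 i).1. Qed.

(** Written with the stacked gradient at a consensus point, so that the Lipschitz bound for stacked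
    gradients compares it with [avg_grad]. *)
Let grad_fbar z : grad fbar z = row_mean (true_grad f ((const_mx 1 : 'cV[R]_n) *m z)).
Proof.
rewrite /fbar grad_objective// /row_mean; congr (_ *: _); apply: eq_bigr => i _.
by apply/rowP => c; rewrite !mxE row_ones_mul.
Qed.

Let true_grad_lip (X Y : 'M[R]_(n, d)) :
  sqnorm (true_grad f X - true_grad f Y) <= L ^+ 2 * sqnorm (X - Y).
Proof.
rewrite sqnorm_row [in leRHS]sqnorm_row mulr_sumr; apply: ler_sum => i _.
have -> : row i (true_grad f X - true_grad f Y) = grad (f i) (row i X) - grad (f i) (row i Y).
  by apply/rowP => c; rewrite !mxE.
rewrite linearB/= -!enorm_sqr -exprMn ler_pXn2r ?nnegrE ?sqrtr_ge0//.
by rewrite mulr_ge0 ?sqrtr_ge0// ltW.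
Qed.

Let avg_gradE (X : 'M[R]_(n, d)) : avg_grad f X = row_mean (true_grad f X).
Proof.
rewrite /avg_grad /row_mean; congr (_ *: _); apply: eq_bigr => i _.
by apply/rowP => c; rewrite !mxE.
Qed.

Lemma avg_grad_gap (X : 'M[R]_(n, d)) :
  sqnorm (grad fbar (row_mean X) - avg_grad f X) <= L ^+ 2 / n%:R * sqnorm (deviation X).
Proof.
rewrite grad_fbar avg_gradE -row_meanB.
apply: le_trans (sqnorm_row_mean_le _ n_gt0) _.
rewrite [_ / _]mulrC -mulrA ler_wpM2l ?invr_ge0//.
apply: le_trans (true_grad_lip _ _) _.
by rewrite -sqnormN opprB.
Qed.

Let fbar_diff z : differentiable (fbar : 'rV[R]_d -> R^o) z.
Proof. exact: objective_differentiable. Qed.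

Let fbar_smooth u v : enorm (grad fbar u - grad fbar v) <= L * enorm (u - v).
Proof.
rewrite -(ler_pXn2r (n := 2)) ?nnegrE ?mulr_ge0 ?sqrtr_ge0 ?(ltW L_gt0)//.
rewrite exprMn !enorm_sqr !grad_fbar -row_meanB.
apply: le_trans (sqnorm_row_mean_le _ n_gt0) _.
apply: le_trans (ler_wpM2l _ (true_grad_lip _ _)) _; first by rewrite invr_ge0.
rewrite -mulmxBr sqnorm_row; under eq_bigr do rewrite row_ones_mul.
rewrite sumr_const card_ord -[sqnorm _ *+ n]mulr_natl [L ^+ 2 * _]mulrCA mulKf ?gt_eqF//.
Qed.

Let h k w := grad fbar (row_mean (x k w)).
Let Dlt k w := fbar (row_mean (x k w)) - fstar.

Let Dlt_ge0 k w : 0 <= Dlt k w. Proof. by rewrite subr_ge0. Qed.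

Let x_rec w k : x k.+1 w = W (k %% tau)%N *m
  (x k w - alpha *: (gt_ft F xi tau W alpha x0 k w).2).
Proof. by rewrite /x /gt_ft_x/=; case: gt_ft. Qed.

Let g_rec w k : (gt_ft F xi tau W alpha x0 k.+1 w).2 =
  W (k %% tau)%N *m (gt_ft F xi tau W alpha x0 k w).2 + y k.+1 w - y k w.
Proof. by rewrite /y x_rec /x /gt_ft_x/=; case: gt_ft. Qed.

(** Descent lemma along the averages. The product of [h] with the averaged gradient is polarized,
    its defect being the gap controlled by the deviation; the product with the noise is kept, since
    its mean vanishes. *)
Lemma pointwise_descent k w :
  Dlt k.+1 w <= Dlt k w - alpha / 2 * sqnorm (h k w)
    - alpha / 2 * (1 - 2 * alpha * L) * sqnorm (avg_grad f (x k w))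
    + alpha * L ^+ 2 / (2 * n%:R) * sqnorm (deviation (x k w))
    + L * alpha ^+ 2 * sqnorm (row_mean (s k w)) - alpha * dot (h k w) (row_mean (s k w)).
Proof.
have xE : row_mean (x k.+1 w) = row_mean (x k w) - alpha *: row_mean (y k w).
  exact: (row_mean_iterate tau_gt0 W_ftc (x := x^~ w) (y := y^~ w) (x_rec w) (g_rec w)).
have yE : row_mean (y k w) = avg_grad f (x k w) + row_mean (s k w).
  by rewrite avg_gradE -row_meanD /s /noise addrC subrK.
have := smooth_upper_bound (row_mean (x k w)) (row_mean (x k.+1 w)) L_gt0 fbar_diff fbar_smooth.
rewrite (_ : _ - row_mean (x k w) = (- alpha) *: row_mean (y k w)); last first.
  by rewrite xE addrAC subrr add0r scaleNr.
rewrite dotZr sqnormZ sqrrN yE dotDr -/(h k w).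
set A := avg_grad _ _; set S := row_mean (s k w); set H := h k w.
have := sqnormD_le A S; have := avg_grad_gap (x k w); rewrite -/A -/(h k w) -/H sqnormB.
set q := sqnorm (deviation _) => h1 h2 h3.
have h4 : alpha / 2 * (sqnorm H + sqnorm A - 2 * dot H A) <= alpha * L ^+ 2 / (2 * n%:R) * q.
  rewrite [leRHS](_ : _ = alpha / 2 * (L ^+ 2 / n%:R * q)); last by field; rewrite gt_eqF.
  by rewrite ler_wpM2l// divr_ge0// ltW.
have h5 : L / 2 * (alpha ^+ 2 * sqnorm (A + S)) <= L * alpha ^+ 2 * (sqnorm A + sqnorm S).
  rewrite [leRHS](_ : _ = L / 2 * (alpha ^+ 2 * (2 * sqnorm A + 2 * sqnorm S))); last by field.
  by apply: ler_wpM2l; [rewrite divr_ge0// ltW|apply: ler_wpM2l => //; exact: sqr_ge0].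
rewrite /Dlt; lra.
Qed.

Lemma pointwise_deviation k w : (tau <= k)%N ->
  sqnorm (deviation (x k w)) <=
    4 * alpha ^+ 2 * tau%:R ^+ 2 * L ^+ 2 *
      (\sum_(m < window tau k) m%:R *
         increment_bound alpha (x^~ w) (y^~ w) (p^~ w) (k - m).-1)
    + 4 * alpha ^+ 2 *
      (sqnorm (\sum_(m < window tau k) m%:R *: (transition tau W (k - m) m *m s (k - m)%N w))
       + sqnorm (\sum_(m < window tau k) m%:R *: (transition tau W (k - m) m *m s (k - m).-1 w))).
Proof.
move=> tk.
apply: (deviation_sqnorm_le n_gt0 tau_gt0 W_ftc
  (x := x^~ w) (y := y^~ w) (g := fun k => (gt_ft F xi tau W alpha x0 k w).2)
  (x_rec w) (g_rec w) _ (p := p^~ w) _ tk) => // i j.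
exact: true_grad_lip.
Qed.

Let dev_meas k : mx_measurable (fun w => deviation (x k w)).
Proof. exact: (mx_measurable_linear deviation). Qed.

Let mean_x_meas k : mx_measurable (fun w => row_mean (x k w)).
Proof. exact: (mx_measurable_linear row_mean). Qed.

Let h_meas_gen dS (S : measurableType dS) (e : S -> Om) k :
  mx_measurable (fun w => x k (e w)) -> mx_measurable (fun w => h k (e w)).
Proof.
move=> mx; rewrite /h; under eq_fun do rewrite grad_fbar.
apply: (mx_measurable_linear row_mean); apply: (true_grad_measurable f_C1).
apply: (mx_measurable_linear (mulmx (const_mx 1 : 'cV[R]_n))).
exact: (mx_measurable_linear row_mean).
Qed.

Let Dlt_meas k : measurable_fun setT (Dlt k).
Proof.
apply: measurable_funB => //.
apply: continuous_mx_measurable (mean_x_meas k) => z.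
exact: differentiable_continuous.
Qed.

Let avg_meas k : mx_measurable (fun w => avg_grad f (x k w)).
Proof.
under eq_fun do rewrite avg_gradE.
apply: (mx_measurable_linear row_mean); exact: (true_grad_measurable f_C1).
Qed.

Hypothesis Delta0_fin : ('E_P[fun w => (fbar (row_mean (x 0%N w)) - fstar)%R] < +oo)%E.
Hypothesis dev_fin : forall k, (k <= tau)%N ->
  ('E_P[fun w => sqnorm (deviation (x k w))] < +oo)%E.

Let Delta0_summable : summable_rv P (Dlt 0%N).
Proof. exact: ge0_summable_rv. Qed.

Let dev_summable k : (k <= tau)%N -> summable_rv P (fun w => sqnorm (deviation (x k w))).
Proof.
move=> /dev_fin; apply: ge0_summable_rv => [|w]; last exact: sqnorm_ge0.
apply: measurable_sum => i; apply: measurable_sum => c.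
exact: measurable_funX (dev_meas k i c).
Qed.

Let mean_s_L2 k : L2mx P (fun w => row_mean (s k w)).
Proof. exact: (L2mx_linear row_mean). Qed.

Let h_L2_of k : summable_rv P (Dlt k) -> L2mx P (h k).
Proof.
move=> iD; apply: (L2mx_le (Y := fun w => 2 * L * Dlt k w)) => [|w|].
- exact: (h_meas_gen (e := id)).
- exact: grad_sqnorm_le.
- exact: summable_rvZ.
Qed.

Let avg_L2_of k : summable_rv P (Dlt k) -> L2mx P (fun w => deviation (x k w)) ->
  L2mx P (fun w => avg_grad f (x k w)).
Proof.
move=> iD iX.
apply: (L2mx_le (avg_meas k) (Y := fun w => 2 * sqnorm (h k w)
    + 2 * (L ^+ 2 / n%:R * sqnorm (deviation (x k w))))) => [w|].
  rewrite -[avg_grad _ _](subKr (h k w)); apply: le_trans (sqnormB_le _ _) _.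
  by rewrite lerD2l ler_wpM2l// avg_grad_gap.
apply: summable_rvD; first exact/summable_rvZ/sqnorm_summable/h_L2_of.
exact/summable_rvZ/summable_rvZ/sqnorm_summable.
Qed.

Let increment_summable j : summable_rv P (Dlt j) ->
  L2mx P (fun w => deviation (x j w)) -> L2mx P (fun w => deviation (x j.+1 w)) ->
  summable_rv P (fun w => increment_bound alpha (x^~ w) (y^~ w) (p^~ w) j).
Proof.
move=> iD iX iX1; apply: summable_rvD.
  by apply: summable_rvD; exact/summable_rvZ/sqnorm_summable.
apply: summable_rvZ; apply: summable_rvD; apply: summable_rvZ; apply: sqnorm_summable.
  by under eq_fun do rewrite -avg_gradE; exact: avg_L2_of.
exact: mean_s_L2.
Qed.

Let weighted_noise_L2 k (time : nat -> nat) t :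
  L2mx P (fun w => \sum_(m < t) m%:R *: (transition tau W (k - m) m *m s (time m) w)).
Proof.
apply: L2mx_sum => m _; apply: L2mxZ.
exact: (L2mx_linear (mulmx (transition tau W (k - m) m))).
Qed.

(** Up to [tau] the deviations are integrable by assumption; beyond, each is bounded by earlier ones
    in its window. The descent inequality then passes integrability of the gap from [k] to
    [k.+1]. *)
Lemma square_summable k : summable_rv P (Dlt k) /\ L2mx P (fun w => deviation (x k w)).
Proof.
elim/ltn_ind: k => k IH.
have iX : L2mx P (fun w => deviation (x k w)).
  have [kt|/ltnW tk] := leqP k tau.
    exact: (L2mx_le (dev_meas k) (fun w => lexx _) (dev_summable kt)).
  apply: (L2mx_le (dev_meas k) (fun w => pointwise_deviation w tk)).
  apply: summable_rvD; last first.
    apply: summable_rvZ; apply: summable_rvD; apply: sqnorm_summable.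
      exact: (weighted_noise_L2 k (fun m => (k - m)%N)).
    exact: (weighted_noise_L2 k (fun m => (k - m).-1)).
  apply: summable_rvZ; apply: summable_rv_sum => -[[|m] /= mt] _.
    (* The increment for [m = 0] involves the deviation at [k] itself; its weight zero keeps the
       induction well founded. *)
    by under eq_fun do rewrite mul0r; exact: summable_rv_cst.
  have mk : (m.+1 < k)%N by exact: leq_trans mt (window_leq tau_gt0 tk).
  have e : ((k - m.+1).-1.+1 = k - m.+1)%N by rewrite prednK// subn_gt0.
  have [|iD iX] := IH (k - m.+1).-1; first by rewrite e leq_subr.
  have [|_ iX1] := IH (k - m.+1)%N; first by rewrite ltn_subrL (leq_ltn_trans _ mk).
  by apply: summable_rvZ; apply: increment_summable; rewrite ?e.
split=> //; case: k IH iX => [//|k] IH iX1; have [iD iX] := IH k (ltnSn k).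
have iH := sqnorm_summable (h_L2_of iD).
have iG := sqnorm_summable (avg_L2_of iD iX).
have i1 := summable_rvB iD (summable_rvZ (alpha / 2) iH).
have i2 := summable_rvB i1 (summable_rvZ (alpha / 2 * (1 - 2 * alpha * L)) iG).
have i3 := summable_rvD i2 (summable_rvZ (alpha * L ^+ 2 / (2 * n%:R)) (sqnorm_summable iX)).
have i4 := summable_rvD i3 (summable_rvZ (L * alpha ^+ 2) (sqnorm_summable (mean_s_L2 k))).
have i5 := summable_rvB i4 (summable_rvZ alpha (dot_summable (h_L2_of iD) (mean_s_L2 k))).
apply: (summable_rv_le (Dlt_meas k.+1) _ i5) => w.
by rewrite ger0_norm//; exact: pointwise_descent.
Qed.

Let Dlt_summable k := (square_summable k).1.
Let dev_L2 k := (square_summable k).2.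
Let h_L2 k := h_L2_of (Dlt_summable k).
Let avg_L2 k := avg_L2_of (Dlt_summable k) (dev_L2 k).

Let EDlt k := mean P (Dlt k).
Let EH k := mean P (fun w => sqnorm (h k w)).
Let EG k := mean P (fun w => sqnorm (avg_grad f (x k w))).
Let ED k := mean P (fun w => sqnorm (deviation (x k w))).

(** [h k] depends on [x k] alone, hence is measurable for the past of [(i, k)] for every agent
    [i]. *)
Let mean_dot_noise k : mean P (fun w => dot (h k w) (row_mean (s k w))) = 0.
Proof.
have -> : (fun w => dot (h k w) (row_mean (s k w))) =
    fun w => \sum_c \sum_i n%:R^-1 * (h k w 0 c * s k w i c).
  apply/funext => w; apply: eq_bigr => c _.
  rewrite -mulr_sumr -mulr_sumr mulrCA; congr (_ * _).
  rewrite /row_mean [LHS]mxE summxE; congr (_ * _).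
  by apply: eq_bigr => i _; rewrite mxE.
have iS c i : summable_rv P (fun w => h k w 0 c * s k w i c).
  by apply: L2_mul; [exact: h_L2|exact: s_L2].
rewrite mean_sum => [|c _]; last first.
  by apply: summable_rv_sum => i _; exact: summable_rvZ.
rewrite big1// => c _; rewrite mean_sum => [|i _]; last exact: summable_rvZ.
rewrite big1// => i _; rewrite meanZ// (@s_past_mean k i c (fun w => h k w 0 c)) ?mulr0//.
  apply: (@h_meas_gen _ (g_sigma_algebraType (others (sampling_sigma xi x0) (Some (i, k))))
    id k _ 0 c).
  exact: past_iterate_measurable.
exact: h_L2.
Qed.

Lemma mean_descent k :
  EDlt k.+1 <= EDlt k - alpha / 2 * EH k - alpha / 2 * (1 - 2 * alpha * L) * EG k
    + alpha * L ^+ 2 / (2 * n%:R) * ED k + L * alpha ^+ 2 * sigma ^+ 2 / n%:R.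
Proof.
have iH := sqnorm_summable (h_L2 k).
have iG := sqnorm_summable (avg_L2 k).
have iD := sqnorm_summable (dev_L2 k).
have iS := sqnorm_summable (mean_s_L2 k).
have iC := dot_summable (h_L2 k) (mean_s_L2 k).
have i1 := summable_rvB (Dlt_summable k) (summable_rvZ (alpha / 2) iH).
have i2 := summable_rvB i1 (summable_rvZ (alpha / 2 * (1 - 2 * alpha * L)) iG).
have i3 := summable_rvD i2 (summable_rvZ (alpha * L ^+ 2 / (2 * n%:R)) iD).
have i4 := summable_rvD i3 (summable_rvZ (L * alpha ^+ 2) iS).
have i5 := summable_rvZ alpha iC.
apply: le_trans (mean_le (Dlt_summable k.+1) (summable_rvB i4 i5) (pointwise_descent k)) _.
rewrite (meanB i4 i5) (meanD i3 (summable_rvZ _ iS)) (meanD i2 (summable_rvZ _ iD)).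
rewrite (meanB i1 (summable_rvZ _ iG)) (meanB (Dlt_summable k) (summable_rvZ _ iH)).
rewrite !meanZ// mean_dot_noise mulr0 subr0 lerD2l.
rewrite -[leRHS]mulrA; apply: ler_wpM2l; first exact: mulr_ge0 (ltW L_gt0) (sqr_ge0 _).
exact: mean_sqnorm_mean_noise.
Qed.

Let mean_increment j :
  mean P (fun w => increment_bound alpha (x^~ w) (y^~ w) (p^~ w) j) <=
  2 * ED j.+1 + 2 * ED j + n%:R * alpha ^+ 2 * (2 * EG j + 2 * (sigma ^+ 2 / n%:R)).
Proof.
have iG := sqnorm_summable (avg_L2 j).
have iD1 := summable_rvZ 2 (sqnorm_summable (dev_L2 j.+1)).
have iD := summable_rvZ 2 (sqnorm_summable (dev_L2 j)).
have iS := sqnorm_summable (mean_s_L2 j).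
have i1 := summable_rvD (summable_rvZ 2 iG) (summable_rvZ 2 iS).
rewrite (_ : (fun w => _) = fun w => 2 * sqnorm (deviation (x j.+1 w))
    + 2 * sqnorm (deviation (x j w)) + n%:R * alpha ^+ 2 *
      (2 * sqnorm (avg_grad f (x j w)) + 2 * sqnorm (row_mean (s j w)))); last first.
  by apply/funext => w; rewrite avg_gradE.
rewrite (meanD (summable_rvD iD1 iD) (summable_rvZ _ i1)) (meanD iD1 iD) !meanZ//; last first.
- exact: sqnorm_summable.
- exact: sqnorm_summable.
rewrite lerD2l; apply: ler_wpM2l; first exact: mulr_ge0 (sqr_ge0 _).
rewrite (meanD (summable_rvZ 2 iG) (summable_rvZ 2 iS)) !meanZ// lerD2l ler_wpM2l//.
exact: mean_sqnorm_mean_noise.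
Qed.

Lemma mean_deviation k : (tau <= k)%N ->
  ED k <= 4 * alpha ^+ 2 * tau%:R ^+ 2 * L ^+ 2 *
     (\sum_(m < (2 * tau).-1 | (m < k)%N) m%:R *
        (2 * ED (k - m).-1.+1 + 2 * ED (k - m).-1
         + n%:R * alpha ^+ 2 * (2 * EG (k - m).-1 + 2 * (sigma ^+ 2 / n%:R))))
     + 64 * n%:R * tau%:R ^+ 3 * alpha ^+ 2 * sigma ^+ 2.
Proof.
move=> tk.
pose incr j := 2 * ED j.+1 + 2 * ED j + n%:R * alpha ^+ 2 * (2 * EG j + 2 * (sigma ^+ 2 / n%:R)).
have ED0 j : 0 <= ED j by apply: mean_ge0 => w; exact: sqnorm_ge0.
have EG0 j : 0 <= EG j by apply: mean_ge0 => w; exact: sqnorm_ge0.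
have incr_ge0 j : 0 <= incr j.
  have := ED0 j; have := ED0 j.+1; have := EG0 j => g d1 d0.
  apply: addr_ge0; first by apply: addr_ge0; exact: mulr_ge0.
  apply: mulr_ge0; first exact: mulr_ge0 (sqr_ge0 _).
  by apply: addr_ge0; apply: mulr_ge0 => //; apply: divr_ge0; rewrite ?sqr_ge0.
have iI j := increment_summable (Dlt_summable j) (dev_L2 j) (dev_L2 j.+1).
have iM (m : 'I_(window tau k)) := summable_rvZ m%:R (iI (k - m).-1).
have i1 := summable_rvZ (4 * alpha ^+ 2 * tau%:R ^+ 2 * L ^+ 2)
  (summable_rv_sum (index_enum _) (Q := xpredT) (fun m _ => iM m)).
have iN1 := sqnorm_summable (weighted_noise_L2 k (fun m => (k - m)%N) (window tau k)).
have iN2 := sqnorm_summable (weighted_noise_L2 k (fun m => (k - m).-1) (window tau k)).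
have i2 := summable_rvZ (4 * alpha ^+ 2) (summable_rvD iN1 iN2).
apply: le_trans (mean_le (sqnorm_summable (dev_L2 k)) (summable_rvD i1 i2)
  (fun w => pointwise_deviation w tk)) _.
rewrite (meanD i1 i2) meanZ; last exact: (summable_rv_sum _ (fun m _ => iM m)).
rewrite meanZ ?(meanD iN1 iN2); last exact: summable_rvD.
apply: lerD.
  apply: ler_wpM2l.
    apply: mulr_ge0 (sqr_ge0 _); apply: mulr_ge0 (sqr_ge0 _).
    exact: mulr_ge0 (sqr_ge0 _).
  rewrite mean_sum => [|m _]; last exact: iM.
  apply: (@le_trans _ _ (\sum_(m < window tau k) m%:R * incr (k - m).-1)).
    apply: ler_sum => m _; rewrite meanZ; last exact: iI.
    by rewrite ler_wpM2l// mean_increment.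
  (* The window length varies with [k]; widening to the fixed range of lags lets the sums over [k]
     and [m] be exchanged later. *)
  rewrite (big_ord_widen_cond _ xpredT (fun m => m%:R * incr (k - m).-1) (window_le tau_gt0 k)).
  rewrite big_mkcond [leRHS]big_mkcond; apply: ler_sum => m _ /=.
  case: ifPn => [mt|_]; first by rewrite (leq_trans mt (window_leq tau_gt0 tk)).
  by case: ifP => // _; apply: mulr_ge0 => //; exact: incr_ge0.
have nt : (window tau k)%:R ^+ 3 <= 8 * tau%:R ^+ 3 :> R.
  rewrite (_ : 8 * _ = (2 * tau%:R) ^+ 3); last by ring.
  rewrite ler_pXn2r ?nnegrE ?mulr_ge0// -natrM ler_nat.
  exact: leq_trans (window_le tau_gt0 k) (leq_pred _).
(* Lags in the window are below [k], so [k - m] is positive and the predecessor loses nothing. *)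
have sub_inj m m' : (m < window tau k)%N -> (m' < window tau k)%N ->
    (k - m).-1 = (k - m').-1 -> m = m'.
  by move: (window_leq tau_gt0 tk) => wk mw m'w; lia.
have N1 := mean_sqnorm_weighted_noise (t := window tau k)
  (A := fun m => transition tau W (k - m) m) (time := fun m => (k - m)%N)
  (fun m => doubly_stochastic_transition tau_gt0 W_ftc _ _)
  (fun m m' mw m'w e => sub_inj m m' mw m'w (congr1 predn e)).
have N2 := mean_sqnorm_weighted_noise (t := window tau k)
  (A := fun m => transition tau W (k - m) m) (time := fun m => (k - m).-1)
  (fun m => doubly_stochastic_transition tau_gt0 W_ftc _ _) sub_inj.
have bound : n%:R * (window tau k)%:R ^+ 3 * sigma ^+ 2 <= n%:R * (8 * tau%:R ^+ 3) * sigma ^+ 2.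
  by apply: ler_wpM2r (sqr_ge0 _) _ _ _; apply: ler_wpM2l.
(* 64 is [4 * (8 + 8)]: two noise sums, each with the cube of a window length at most [2 * tau]. *)
rewrite (_ : 64 * _ * _ * _ * _ = 4 * alpha ^+ 2 *
  (n%:R * (8 * tau%:R ^+ 3) * sigma ^+ 2 + n%:R * (8 * tau%:R ^+ 3) * sigma ^+ 2)); last by ring.
apply: ler_wpM2l; first exact: mulr_ge0 (sqr_ge0 _).
by apply: lerD; [exact: le_trans N1 bound|exact: le_trans N2 bound].
Qed.

Lemma gradients_summable k :
  summable_rv P (fun w => sqnorm (avg_grad f (x k w))) /\
  summable_rv P (fun w => sqnorm (grad fbar (row_mean (x k w)))).
Proof.
by split; apply: sqnorm_summable; [exact: avg_L2|exact: h_L2].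
Qed.

Hypothesis alpha_le : alpha <= 1 / (4 * Num.sqrt 6 * tau%:R ^+ 2 * L).

Lemma convergence_bound T : (tau <= T)%N ->
  T.+1%:R^-1 * \sum_(k < T.+1) (mean P (fun w => sqnorm (avg_grad f (x k w)))
      + mean P (fun w => sqnorm (grad fbar (row_mean (x k w))))) <=
    (4 * mean P (fun w => fbar (row_mean (x 0%N w)) - fstar)) / (alpha * T%:R)
    + (3 * \sum_(k < tau.+1) mean P (fun w => sqnorm (deviation (x k w))))
        * L ^+ 2 / (n%:R * T%:R)
    + 48 * alpha ^+ 4 * tau%:R ^+ 4 * L ^+ 4 * sigma ^+ 2 / n%:R
    + 192 * alpha ^+ 2 * tau%:R ^+ 3 * L ^+ 2 * sigma ^+ 2
    + 4 * alpha * L * sigma ^+ 2 / n%:R.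
Proof.
apply: (sum_gradients_le n_gt0 tau_gt0 alpha_gt0 L_gt0 alpha_le
  (D := ED) (G := EG) (H := EH) (Delta := EDlt)).
- by move=> k; apply: mean_ge0 => w; exact: sqnorm_ge0.
- by move=> k; apply: mean_ge0 => w; exact: sqnorm_ge0.
- by move=> k; apply: mean_ge0 => w; exact: sqnorm_ge0.
- by move=> k; apply: mean_ge0.
- exact: mean_deviation.
- exact: mean_descent.
Qed.

End convergence.

Theorem theorem5p3 (R : realType) :
  exists (gamma1 gamma2 : R -> R) (gamma3 gamma4 gamma5 : R),
    [/\ forall e, 0 < gamma1 e, forall e, 0 < gamma2 e,
        0 < gamma3, 0 < gamma4 & 0 < gamma5] /\
  forall (n d : nat) (hn : (0 < n)%N)
    (* the objective *)
    (dO : 'I_n -> measure_display) (Omg : forall i, measurableType (dO i))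
    (P_ : forall i, probability (Omg i) R)
    (dX : 'I_n -> measure_display) (Xi : forall i, measurableType (dX i))
    (xi0 : forall i, {mfun Omg i >-> Xi i})
    (F : forall i, 'rV[R]_d -> Xi i -> R)
    (F_meas : forall i x, measurable_fun setT (F i x))
    (F_diff : forall i z x,
       differentiable ((fun y => F i y z) : 'rV[R]_d -> R^o) x)
    (F_int : forall i x,
       (P_ i).-integrable setT (fun w => (F i x (xi0 i w))%:E)),
  let f := local_objective P_ xi0 F in
  let fbar := objective f in
  let fstar := inf (range fbar) in
  forall (f_C1 : forall i, continuously_differentiable (f i))
    (L : R) (L_gt0 : 0 < L)
    (f_smooth : forall i x y,
       enorm (grad (f i) x - grad (f i) y) <= L * enorm (x - y))
    (f_bdd : has_lbound (range fbar))
    (* the mixing matrices and the stepsize *)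
    (tau : nat) (tau_gt0 : (0 < tau)%N)
    (W : nat -> 'M[R]_n) (W_ftc : finite_time_consensus tau W)
    (alpha : R) (alpha_gt0 : 0 < alpha)
    (alpha_le : alpha <= 1 / (4 * Num.sqrt 6 * tau%:R ^+ 2 * L))
    (* the initial point and the samples *)
    (dP : measure_display) (Om : measurableType dP) (P : probability Om R)
    (x0 : Om -> 'M[R]_(n, d))
    (x0_meas : forall i c, measurable_fun setT (fun w => x0 w i c))
    (xi : forall i, nat -> {mfun Om >-> Xi i})
    (xi_indep : mutually_independent P (sampling_sigma xi x0)),
  let x := gt_ft_x F xi tau W alpha x0 in
  forall
    (unbiased : forall k i c, is_cond_expectation P (history x k)
       (fun w => stoch_grad F xi k w (x k w) i c)
       (fun w => grad (f i) (row i (x k w)) 0 c))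
    (sigma : R) (sigma_gt0 : 0 < sigma)
    (bounded_var : forall k i, exists2 V : Om -> R,
       is_cond_expectation P (history x k)
         (fun w => enorm (row i (stoch_grad F xi k w (x k w))
                          - grad (f i) (row i (x k w))) ^+ 2) V
       & {ae P, forall w, V w <= sigma ^+ 2})
    (Delta0 : R)
    (Delta0E :
       ('E_P[(fun w => fbar (row_mean (x 0%N w)) - fstar)%R])%E = Delta0%:E)
    (S0 : R)
    (S0E : (\sum_(0 <= k < tau.+1)
              'E_P[(fun w => enorm (deviation (x k w)) ^+ 2)%R])%E = S0%:E)
    (T : nat) (T_ge : (tau <= T)%N),
  ((T.+1%:R^-1)%:E *
     \sum_(0 <= k < T.+1)
       ('E_P[(fun w => enorm (avg_grad f (x k w)) ^+ 2)%R] +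
        'E_P[(fun w => enorm (grad fbar (row_mean (x k w))) ^+ 2)%R])
   <= (gamma1 Delta0 / (alpha * T%:R)
       + gamma2 S0 * L ^+ 2 / (n%:R * T%:R)
       + gamma3 * alpha ^+ 4 * tau%:R ^+ 4 * L ^+ 4 * sigma ^+ 2 / n%:R
       + gamma4 * alpha ^+ 2 * tau%:R ^+ 3 * L ^+ 2 * sigma ^+ 2
       + gamma5 * alpha * L * sigma ^+ 2 / n%:R)%R%:E)%E.

Proof.
(* The absolute value and the added one make both functions positive at every real argument while
   they still dominate [4 * e] and [3 * e]. *)
exists (fun e => 4 * `|e| + 1), (fun e => 3 * `|e| + 1), 48, 192, 4; split.
  by split=> // e; rewrite ltr_pwDr// mulr_ge0.
move=> n d hn dO Omg P_ dX Xi xi0 F F_meas F_diff F_int f fbar fstar f_C1 L L_gt0 f_smooth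
  f_bdd tau tau_gt0 W W_ftc alpha alpha_gt0 alpha_le dP Om P x0 x0_meas xi xi_indep x
  unbiased sigma sigma_gt0 bounded_var Delta0 Delta0E S0 S0E T T_ge.
have fstar_le z : fstar <= fbar z by apply: ge_inf => //; exists z.
have sqE : forall m p (X : Om -> 'M[R]_(m, p)),
    (fun w => enorm (X w) ^+ 2) = (fun w => sqnorm (X w)).
  by move=> m p X; apply/funext => w; rewrite enorm_sqr.
have Delta0_fin : ('E_P[fun w => (fbar (row_mean (x 0%N w)) - fstar)%R] < +oo)%E.
  by rewrite Delta0E ltry.
(* A finite sum of nonnegative expectations bounds each of its terms. *)
have dev_fin k : (k <= tau)%N -> ('E_P[fun w => sqnorm (deviation (x k w))] < +oo)%E.
  move=> kt; rewrite -sqE; apply: (@le_lt_trans _ _ S0%:E); last exact: ltry.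
  rewrite -S0E big_mkord (bigD1 (Ordinal (kt : (k < tau.+1)%N)))//= leeDl//.
  by apply: sume_ge0 => i _; apply: expectation_ge0 => w; exact: sqr_ge0.
have sq := square_summable F_meas F_diff f_C1 hn L_gt0 f_smooth fstar_le tau_gt0 W_ftc
  alpha_gt0 x0_meas bounded_var Delta0_fin dev_fin.
have gr := gradients_summable F_meas F_diff f_C1 hn L_gt0 f_smooth fstar_le tau_gt0 W_ftc
  alpha_gt0 x0_meas bounded_var Delta0_fin dev_fin.
have bound := convergence_bound F_meas F_diff f_C1 hn L_gt0 f_smooth fstar_le tau_gt0 W_ftc
  alpha_gt0 x0_meas xi_indep unbiased bounded_var Delta0_fin dev_fin alpha_le T_ge.
have Delta0_mean : mean P (fun w => fbar (row_mean (x 0%N w)) - fstar) = Delta0.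
  by apply: EFin_inj; rewrite -Delta0E meanE//; exact: (sq 0%N).1.
have S0_mean : \sum_(k < tau.+1) mean P (fun w => sqnorm (deviation (x k w))) = S0.
  apply: EFin_inj; rewrite -S0E big_mkord -sumEFin; apply: eq_bigr => k _.
  by rewrite sqE meanE//; apply: sqnorm_summable; exact: (sq k).2.
rewrite big_mkord (eq_bigr (fun k : 'I_T.+1 =>
  (mean P (fun w => sqnorm (avg_grad f (x k w)))
   + mean P (fun w => sqnorm (grad fbar (row_mean (x k w)))))%:E)) => [|k _]; last first.
  by rewrite !sqE EFinD; have [iA iG] := gr k; rewrite (meanE iA) (meanE iG).
rewrite sumEFin -EFinM lee_fin; apply: le_trans bound _.
rewrite Delta0_mean S0_mean !lerD2r.
have T_gt0 : 0 < T%:R :> R by rewrite ltr0n (leq_trans tau_gt0).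
apply: lerD.
  apply: ler_wpM2r; first by rewrite invr_ge0 ltW// mulr_gt0.
  by have := ler_norm Delta0; lra.
apply: ler_wpM2r; first by rewrite invr_ge0 mulr_ge0.
by apply: ler_wpM2r; [exact: sqr_ge0|have := ler_norm S0; lra].
Qed.
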